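(* Let $(A,\succ,\prec)$ be a Leibniz-dendriform algebra, $r=\sum_iu_i\otimes v_i\in A\otimes A$, and let $(B=\bigoplus_{i\in\mathbb Z}B_i,\diamond,\omega)$ be a quadratic $\mathbb Z$-graded Zinbiel algebra. Let $A\otimes B$ carry the pre-Lie product $$(a\otimes x)\cdot(b\otimes y)=(a\succ b)\otimes (x\diamond y)-(b\prec a)\otimes (y\diamond x),$$ let $\{e_j\}_{j\in\Omega}$ be a homogeneous basis of $B$ with homogeneous dual basis $\{f_j\}_{j\in\Omega}$ with respect to $\omega$, and put $$\hat r=\sum_i\sum_{j\in\Omega}(u_i\otimes e_j)\otimes(v_i\otimes f_j)\in(A\otimes B)\hat\otimes(A\otimes B),\qquad \delta_{\hat r}(X)=-\big(L_\cdot(X)\hat\otimes I+I\hat\otimes(L_\cdot(X)-R_\cdot(X))\big)\hat r\quad(X\in A\otimes B).$$ If $(A,\succ,\prec,\Delta_{\succ,r},\Delta_{\prec,r})$ is a quasi-triangular Leibniz-dendriform bialgebra, then $(A\otimes B,\cdot,\delta_{\hat r})$ is a completed quasi-triangular pre-Lie bialgebra. In particular, if $(A,\succ,\prec,\Delta_{\succ,r},\Delta_{\prec,r})$ is triangular, then $(A\otimes B,\cdot,\delta_{\hat r})$ is a completed triangular pre-Lie bialgebra.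
   Context: All vector spaces are over a field $\mathbb K$; $\tau$ is the flip, $I$ the identity. Algebras are finite-dimensional except $\mathbb Z$-graded ones. $L_\ast(a)b=a\ast b$, $R_\ast(a)b=b\ast a$. Completed tensor products: for $\mathbb Z$-graded $U=\bigoplus U_i$, $V=\bigoplus V_j$, $U\hat\otimes V:=\prod_{i,j}U_i\otimes V_j$ (similarly for three factors); linear maps and the flip ($\hat\tau$) are extended termwise to formal sums. $A$ is in degree $0$, $A\otimes B=\bigoplus_iA\otimes B_i$. Leibniz-dendriform algebra: bilinear $\succ,\prec$ such that, with $x\circ y=x\succ y+x\prec y$: $(x\circ y)\succ z=x\succ(y\succ z)-y\succ(x\succ z)$; $y\prec(x\circ z)+(x\succ y)\prec z=x\succ(y\prec z)$; $x\prec(y\circ z)=(x\prec y)\prec z+y\succ(x\prec z)$. Put $x\odot y=x\succ y+y\prec x$, $L_\odot=L_\succ+R_\prec$, $L_\star=L_\circ+R_\circ$. LD-YBE for $r=\sum_iu_i\otimes v_i$: $\sum_{i,j}\big(u_j\otimes u_i\otimes (v_i\circ v_j)-u_i\otimes(v_i\odot u_j)\otimes v_j-(u_i\succ u_j)\otimes v_i\otimes v_j\big)=0$. An element $s\in A\otimes A$ is invariant if $(L_\odot(x)\otimes I-I\otimes R_\circ(x))s=0$ and $(L_\star(x)\otimes I-I\otimes R_\prec(x))\tau(s)=0$ for all $x\in A$. For $r\in A\otimes A$: $\Delta_{\succ,r}(x)=(L_\odot(x)\otimes I-I\otimes R_\circ(x))r$, $\Delta_{\prec,r}(x)=(L_\star(x)\otimes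 I-I\otimes R_\prec(x))\tau(r)$. If $r$ is a solution of the LD-YBE and $r+\tau(r)$ is invariant, then $(A,\succ,\prec,\Delta_{\succ,r},\Delta_{\prec,r})$ (which is then known to be a Leibniz-dendriform bialgebra) is called a quasi-triangular Leibniz-dendriform bialgebra; it is called triangular if moreover $r$ is skew-symmetric. Quadratic $\mathbb Z$-graded Zinbiel algebra $(B=\bigoplus B_i,\diamond,\omega)$: each $B_i$ is finite-dimensional, $B_i\diamond B_j\subseteq B_{i+j}$, $x\diamond(y\diamond z)=(x\diamond y)\diamond z+(y\diamond x)\diamond z$, $\omega$ is a non-degenerate skew-symmetric bilinear form, invariant ($\omega(x\diamond y,z)=\omega(y,x\diamond z+z\diamond x)$) and graded (there is $m\in\mathbb Z$ with $\omega(B_i,B_j)=0$ whenever $i+j+m\neq0$). Dual basis: $\omega(e_i,f_j)=\delta_{ij}$. Pre-Lie algebra $(L,\cdot)$: $(x\cdot y)\cdot z-x\cdot(y\cdot z)=(y\cdot x)\cdot z-y\cdot(x\cdot z)$; $[x,y]=x\cdot y-y\cdot x$. Completed pre-Lie coalgebra $(L,\delta)$: $L=\bigoplus L_i$, $\delta:L\to L\hat\otimes L$ linear with $(I\hat\otimes\delta)\delta-(\hat\tau\hat\otimes I)(I\hat\otimes\delta)\delta=(\delta\hat\otimes I)\delta-(\hat\tau\hat\otimes I)(\delta\hat\otimes I)\delta$. Completed pre-Lie bialgebra $(L,\cdot,\delta)$: $(L,\cdot)$ pre-Lie algebra, $(L,\delta)$ completed pre-Lie coalgebra, and for all $a,b\in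 L$: $(\delta-\hat\tau\delta)(a\cdot b)-(L_\cdot(a)\hat\otimes I)(\delta-\hat\tau\delta)(b)-(I\hat\otimes L_\cdot(a))(\delta-\hat\tau\delta)(b)-(I\hat\otimes R_\cdot(b))\delta(a)+(R_\cdot(b)\hat\otimes I)\hat\tau\delta(a)=0$; $\delta(a\cdot b-b\cdot a)-(I\hat\otimes(R_\cdot(b)-L_\cdot(b)))\delta(a)-(I\hat\otimes(L_\cdot(a)-R_\cdot(a)))\delta(b)-(L_\cdot(a)\hat\otimes I)\delta(b)+(L_\cdot(b)\hat\otimes I)\delta(a)=0$. For a $\mathbb Z$-graded pre-Lie algebra $L$, $\hat r=\sum_ia_i\otimes b_i\in L\hat\otimes L$ is a completed solution of the $S$-equation if $\sum_{i,j}\big((a_i\cdot a_j)\otimes b_i\otimes b_j-a_i\otimes(b_i\cdot a_j)\otimes b_j-a_i\otimes a_j\otimes[b_i,b_j]\big)=0$; $\hat s\in L\hat\otimes L$ is invariant if $\big(L_\cdot(x)\hat\otimes I+I\hat\otimes(L_\cdot(x)-R_\cdot(x))\big)\hat s=0$ for all $x$. A completed pre-Lie bialgebra $(L,\cdot,\delta_{\hat r})$, with $\delta_{\hat r}(x)=-\big(L_\cdot(x)\hat\otimes I+I\hat\otimes(L_\cdot(x)-R_\cdot(x))\big)\hat r$, is completed quasi-triangular if $\hat r$ is a completed solution of the $S$-equation and $\hat r-\hat\tau(\hat r)$ is invariant, and completed triangular if moreover $\hat r$ is symmetric. *)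

(* Defs.v *)
From HB Require Import structures.
From mathcomp Require Import all_boot all_order all_algebra.
From mathcomp Require Import boolp classical_sets functions cardinality fsbigop.

Set Implicit Arguments.
Unset Strict Implicit.
Unset Printing Implicit Defensive.

Import GRing.Theory.

Local Open Scope classical_set_scope.
Local Open Scope ring_scope.

Definition is_bilinear (K : fieldType) (U V W : lmodType K)
    (f : U -> V -> W) : Prop :=
  (forall u, linear (f u)) /\ (forall v, linear (f ^~ v)).

Definition is_bilinear_form (K : fieldType) (U V : lmodType K)
    (f : U -> V -> K) : Prop :=
  (forall u, scalar (f u)) /\ (forall v, scalar (f ^~ v)).

Lemma linear_at0 (K : fieldType) (U V : lmodType K) (f : U -> V) :
  linear f -> f 0 = 0.
Proof. by move=> /(_ (-1) 0 0); rewrite scaler0 addr0 scaleN1r addNr. Qed.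

Section Tensor.
Variable K : fieldType.
Implicit Types U V : vectType K.

(* [tens U V] is the tensor product of finite-dimensional spaces, realised as
   matrices of coordinates in the library's bases of [U] and [V]; it is only
   used through [tensv] and its universal property ([tensv_bilinear],
   [tlift_linear], [tlift_tensv], [tlift_uniq]), so the bases are immaterial. *)
Definition tens U V : vectType K := 'M[K]_(\dim {:U}, \dim {:V}).

Definition tensv U V (u : U) (v : V) : tens U V :=
  \matrix_(i, j) (coord (vbasis {:U}) i u * coord (vbasis {:V}) j v).

Definition tlift U V (W : lmodType K) (b : U -> V -> W) (s : tens U V) : W :=
  \sum_i \sum_j s i j *: b (vbasis {:U})`_i (vbasis {:V})`_j.

Local Notation "u ⊗ v" := (tensv u v) (at level 38, left associativity).

Lemma tensv_bilinear U V : is_bilinear (@tensv U V).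
Proof.
split=> [u a v w|v a u w]; apply/matrixP => i j; rewrite !mxE linearP /=.
  by rewrite mulrDr mulrCA.
by rewrite mulrDl mulrA.
Qed.

Lemma tlift_linear U V (W : lmodType K) (b : U -> V -> W) : linear (tlift b).
Proof.
move=> a s t; rewrite /tlift scaler_sumr -big_split; apply: eq_bigr => i _.
rewrite /= scaler_sumr -big_split; apply: eq_bigr => j _ /=.
by rewrite !mxE scalerDl scalerA.
Qed.

Lemma linear_sum_coord U (W : lmodType K) (f : U -> W) (u : U) :
  linear f ->
  f u = \sum_i coord (vbasis {:U}) i u *: f (vbasis {:U})`_i.
Proof.
move=> fl.
pose F := HB.pack_for {linear U -> W} f (GRing.isLinear.Build _ _ _ _ f fl).
rewrite -[LHS]/(F u) {1}(coord_vbasis (memvf u)) linear_sum.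
by apply: eq_bigr => i _; rewrite linearZ.
Qed.

Lemma tlift_tensv U V (W : lmodType K) (b : U -> V -> W) u v :
  is_bilinear b -> tlift b (u ⊗ v) = b u v.
Proof.
move=> [bl br]; rewrite (linear_sum_coord u (br v)).
apply: eq_bigr => i _; rewrite (linear_sum_coord v (bl _)) scaler_sumr.
by apply: eq_bigr => j _; rewrite mxE scalerA.
Qed.

Lemma tlift_uniq U V (W : lmodType K) (f g : tens U V -> W) :
  linear f -> linear g -> (forall u v, f (u ⊗ v) = g (u ⊗ v)) -> f =1 g.
Proof.
move=> fl gl fg s.
pose F := HB.pack_for {linear (tens U V) -> W} f
  (GRing.isLinear.Build _ _ _ _ f fl).
pose G := HB.pack_for {linear (tens U V) -> W} g
  (GRing.isLinear.Build _ _ _ _ g gl).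
have -> : s = \sum_i \sum_j
    s i j *: ((vbasis {:U})`_i ⊗ (vbasis {:V})`_j) :> tens U V.
  rewrite {1}(matrix_sum_delta s).
  apply: eq_bigr => i _; apply: eq_bigr => j _; congr (_ *: _).
  apply/matrixP => k l; rewrite !mxE.
  rewrite !coord_free ?(basis_free (vbasisP _)) //.
  by rewrite -natrM mulnb [k == i]eq_sym [l == j]eq_sym.
rewrite -[LHS]/(F _) -[RHS]/(G _) !linear_sum; apply: eq_bigr => i _.
rewrite !linear_sum; apply: eq_bigr => j _.
by rewrite !linearZ /= fg.
Qed.

End Tensor.

Notation "u ⊗ v" := (tensv u v) (at level 38, left associativity) : ring_scope.

Section TensorMaps.
Variable K : fieldType.

Definition tmap (U V U' V' : vectType K) (f : U -> U') (g : V -> V') :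
    tens U V -> tens U' V' := tlift (fun u v => f u ⊗ g v).

Definition swap (U V : vectType K) : tens U V -> tens V U :=
  tlift (fun u v => v ⊗ u).

End TensorMaps.

Section LeibnizDendriform.
Variables (K : fieldType) (A : vectType K) (succ prec : A -> A -> A).
Implicit Types (x y z : A) (r s : tens A A).

Definition circ x y := succ x y + prec x y.
Definition odot x y := succ x y + prec y x.
Definition star x y := circ x y + circ y x.

Definition leibniz_dendriform : Prop :=
  [/\ is_bilinear succ, is_bilinear prec,
      forall x y z,
        succ (circ x y) z = succ x (succ y z) - succ y (succ x z),
      forall x y z,
        prec y (circ x z) + prec (succ x y) z = succ x (prec y z) &
      forall x y z,
        prec x (circ y z) = prec (prec x y) z + succ y (prec x z)].

Definition LD_YBE r : Prop :=
  tlift (fun ui vi => tlift (fun uj vj =>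
      uj ⊗ ui ⊗ circ vi vj
    - ui ⊗ odot vi uj ⊗ vj
    - succ ui uj ⊗ vi ⊗ vj) r) r = 0.

Definition Delta_succ r x : tens A A :=
  tmap (odot x) idfun r - tmap idfun (circ ^~ x) r.

Definition Delta_prec r x : tens A A :=
  tmap (star x) idfun (swap r) - tmap idfun (prec ^~ x) (swap r).

(* The two invariance conditions on [s] are literally the vanishing of the
   operators defining [Delta_succ s] and [Delta_prec s]. *)
Definition LD_invariant s : Prop :=
  forall x, Delta_succ s x = 0 /\ Delta_prec s x = 0.

Definition quasi_triangular_LD_bialgebra r : Prop :=
  [/\ leibniz_dendriform, LD_YBE r & LD_invariant (r + swap r)].

Definition triangular_LD_bialgebra r : Prop :=
  quasi_triangular_LD_bialgebra r /\ swap r = - r.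

End LeibnizDendriform.

Section Product.
Variables (K : fieldType) (T : Type) (W : T -> vectType K).

Definition cprod : Type := forall t, W t.

Fact cprodP (s s' : cprod) : (forall t, s t = s' t) -> s = s'.
Proof. exact: functional_extensionality_dep. Qed.

HB.instance Definition _ := gen_eqMixin cprod.
HB.instance Definition _ := gen_choiceMixin cprod.

Let add (s s' : cprod) : cprod := fun t => s t + s' t.
Let opp (s : cprod) : cprod := fun t => - s t.
Let zero : cprod := fun t => 0.
Let scale (a : K) (s : cprod) : cprod := fun t => a *: s t.

Fact cprod_addA : associative add.
Proof. by move=> s s' s''; apply: cprodP => t; apply: addrA. Qed.
Fact cprod_addC : commutative add.
Proof. by move=> s s'; apply: cprodP => t; apply: addrC. Qed.
Fact cprod_add0 : left_id zero add.
Proof. by move=> s; apply: cprodP => t; apply: add0r. Qed.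
Fact cprod_addN : left_inverse zero opp add.
Proof. by move=> s; apply: cprodP => t; apply: addNr. Qed.

HB.instance Definition _ :=
  GRing.isZmodule.Build cprod cprod_addA cprod_addC cprod_add0 cprod_addN.

Fact cprod_scaleA a b s : scale a (scale b s) = scale (a * b) s.
Proof. by apply: cprodP => t; apply: scalerA. Qed.
Fact cprod_scale1 : left_id 1 scale.
Proof. by move=> s; apply: cprodP => t; apply: scale1r. Qed.
Fact cprod_scaleDr : right_distributive scale +%R.
Proof. by move=> a s s'; apply: cprodP => t; apply: scalerDr. Qed.
Fact cprod_scaleDl s : {morph scale^~ s : a b / a + b}.
Proof. by move=> a b; apply: cprodP => t; apply: scalerDl. Qed.

HB.instance Definition _ := GRing.Zmodule_isLmodule.Build K cprod
  cprod_scaleA cprod_scale1 cprod_scaleDr cprod_scaleDl.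

(* formal (possibly infinite) sum, computed in each component *)
Definition csum (J : choiceType) (s : J -> cprod) : cprod :=
  fun t => \sum_(j \in [set: J]) s j t.

End Product.

(* A Z-graded space with finite-dimensional components is given by the family
   of its components; [dsum V] is its total space, the direct sum. *)
Section DirectSum.
Variables (K : fieldType) (V : int -> vectType K).

Definition finsupp : pred (cprod V) :=
  fun x => `[< finite_set [set i | x i != 0] >].

Fact finsupp_submod : submod_closed finsupp.
Proof.
split=> [|a x y /asboolP fx /asboolP fy]; apply/asboolP.
  by apply: (sub_finite_set (B := set0)) => // i /=; rewrite eqxx.
apply: (sub_finite_set (B := [set i | x i != 0] `|` [set i | y i != 0])).
  move=> i /=; case: (eqVneq (x i) 0) => [xi|]; last by left.
  case: (eqVneq (y i) 0) => [yi|]; last by right.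
  by rewrite /GRing.add /= /GRing.scale /= xi yi scaler0 addr0 eqxx.
by rewrite finite_setU.
Qed.

HB.instance Definition _ :=
  GRing.isSubmodClosed.Build K (cprod V) finsupp finsupp_submod.

Record dsum : Type := DSum { dsum_val : cprod V; _ : finsupp dsum_val }.

Definition component (x : dsum) (i : int) : V i := dsum_val x i.
Coercion component : dsum >-> Funclass.

HB.instance Definition _ := [isSub for dsum_val].
HB.instance Definition _ := [Choice of dsum by <:].
HB.instance Definition _ := [SubChoice_isSubLmodule of dsum by <:].

Fact finsupp_inj i (v : V i) :
  finsupp (dfwith (fun k => 0 : V k) v : cprod V).
Proof.
apply/asboolP; apply: (sub_finite_set (B := [set i])) => // j /=.
by case: dfwithP => //= k; rewrite eqxx.
Qed.

Definition inj i (v : V i) : dsum := DSum (finsupp_inj v).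

Lemma componentD (x y : dsum) i : (x + y) i = x i + y i.
Proof. by []. Qed.

Lemma componentZ a (x : dsum) i : (a *: x) i = a *: x i.
Proof. by []. Qed.

Lemma component_sum (J : Type) (s : seq J) (x : J -> dsum) i :
  (\sum_(j <- s) x j) i = \sum_(j <- s) x j i.
Proof. by elim/big_rec2: _ => // j y z _ <-. Qed.

Lemma dsumP (x y : dsum) : (forall i, x i = y i) -> x = y.
Proof.
by move=> xy; apply: val_inj; apply: functional_extensionality_dep => i.
Qed.

Lemma inj_in i (v : V i) : inj v i = v.
Proof. exact: dfwith_in. Qed.

Lemma inj_out i j (v : V i) : i != j -> inj v j = 0.
Proof. exact: dfwith_out. Qed.

Lemma inj_linear i : linear (@inj i).
Proof.
move=> a v w; apply: dsumP => j; rewrite componentD componentZ.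
have [ij|ij] := eqVneq i j; last by rewrite !inj_out // scaler0 addr0.
by subst j; rewrite !inj_in.
Qed.

Lemma dsum_support (x : dsum) :
  exists2 s : seq int, uniq s & forall i, i \notin s -> x i = 0.
Proof.
case: x => x /= xs; have /asboolP fx := xs.
exists (finmap.enum_fset (fset_set [set i | x i != 0])).
  exact: finmap.fset_uniq.
move=> i; rewrite in_fset_set // => /negP; rewrite inE /= => /negP.
by rewrite negbK => /eqP.
Qed.

Lemma dsum_decomp (x : dsum) (s : seq int) :
  uniq s -> (forall i, i \notin s -> x i = 0) -> x = \sum_(i <- s) inj (x i).
Proof.
move=> us xs; apply: dsumP => i; rewrite component_sum.
have [si|si] := boolP (i \in s); last first.
  rewrite xs // big1_seq // => j /andP[_ sj].
  by rewrite inj_out //; apply: contraNneq si => <-.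
rewrite (bigD1_seq i) // inj_in big1 => [|j ji]; first exact/esym/addr0.
by rewrite inj_out.
Qed.

Definition homog (i : int) (x : dsum) : Prop := forall k, k != i -> x k = 0.

Definition homogeneous (x : dsum) : Prop := exists i, homog i x.

Definition is_basis (Omega : choiceType) (e : Omega -> dsum) : Prop :=
  (forall (s : seq Omega) (c : Omega -> K), uniq s ->
     \sum_(j <- s) c j *: e j = 0 -> forall j, j \in s -> c j = 0) /\
  (forall x, exists (s : seq Omega) (c : Omega -> K),
     x = \sum_(j <- s) c j *: e j).

Definition graded_mul (mul : dsum -> dsum -> dsum) : Prop :=
  forall i j x y, homog i x -> homog j y -> homog (i + j) (mul x y).

End DirectSum.

Section Zinbiel.
Variables (K : fieldType) (B : int -> vectType K).
Variables (dia : dsum B -> dsum B -> dsum B) (omega : dsum B -> dsum B -> K).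

Definition zinbiel : Prop :=
  is_bilinear dia /\
  forall x y z, dia x (dia y z) = dia (dia x y) z + dia (dia y x) z.

Definition graded_form : Prop :=
  exists m : int, forall i j x y,
    homog i x -> homog j y -> i + j + m != 0 -> omega x y = 0.

Definition quadratic_graded_zinbiel : Prop :=
  [/\ zinbiel /\ graded_mul dia,
      is_bilinear_form omega /\ graded_form,
      forall x y, omega x y = - omega y x,
      forall x, (forall y, omega x y = 0) -> x = 0 &
      forall x y z, omega (dia x y) z = omega y (dia x z + dia z x)].

Definition dual_bases (Omega : choiceType) (e f : Omega -> dsum B) : Prop :=
  [/\ is_basis e, is_basis f &
      forall i j, omega (e i) (f j) = (i == j)%:R].

End Zinbiel.

Section Completed.
Variable K : fieldType.
Implicit Types U V W : int -> vectType K.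

Definition ctens U V : lmodType K :=
  cprod (fun t : int * int => tens (U t.1) (V t.2)).

Definition ctens3 U V W : lmodType K :=
  cprod (fun t : int * int * int => tens (tens (U t.1.1) (V t.1.2)) (W t.2)).

Definition cten U V (x : dsum U) (y : dsum V) : ctens U V :=
  fun t => x t.1 ⊗ y t.2.

Definition cten3 U V W (x : dsum U) (y : dsum V) (z : dsum W) :
    ctens3 U V W :=
  fun t => x t.1.1 ⊗ y t.1.2 ⊗ z t.2.

(* Termwise extension of a bilinear map [phi] to the formal sums of the
   completed tensor product: the [t]-component of the value at [s] is the sum,
   over all bidegrees, of the [t]-components of the values at the terms of [s].
   It is meaningful when these sums are finite ([extendable]); [fsbigop] returns
   0 otherwise. *)
Section Extension.
Variables (U V : int -> vectType K) (T : Type) (W : T -> vectType K).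
Variable phi : dsum U -> dsum V -> cprod W.

Definition ext_term (s : ctens U V) (t : T) (pq : int * int) : W t :=
  tlift (fun u v => phi (inj u) (inj v) t) (s pq).

Definition extendable (s : ctens U V) : Prop :=
  forall t, finite_set [set pq | ext_term s t pq != 0].

Definition ext (s : ctens U V) : cprod W :=
  fun t => \sum_(pq \in [set: int * int]) ext_term s t pq.

End Extension.

Lemma ext_term_cten U V (T : Type) (W : T -> vectType K)
    (phi : dsum U -> dsum V -> cprod W) x y t pq :
  is_bilinear phi ->
  ext_term phi (cten x y) t pq = phi (inj (x pq.1)) (inj (y pq.2)) t.
Proof.
move=> [bl br]; rewrite /ext_term /cten tlift_tensv //; split=> [u|v] a w w'.
  by rewrite inj_linear bl.
by rewrite inj_linear br.
Qed.

Lemma extend_cten U V (T : Type) (W : T -> vectType K)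
    (phi : dsum U -> dsum V -> cprod W) x y :
  is_bilinear phi ->
  extendable phi (cten x y) /\ ext phi (cten x y) = phi x y.
Proof.
move=> bphi; have [bl br] := bphi.
have phi0r z : phi z 0 = 0 := linear_at0 (bl z).
have phi0l z : phi 0 z = 0 := linear_at0 (br z).
have inj0 Z i : @inj K Z i 0 = 0 := linear_at0 (@inj_linear K Z i).
have [s us xs] := dsum_support x; have [s' us' ys] := dsum_support y.
pose r := [seq (i, j) | i <- s, j <- s'].
have ur : uniq r by apply: allpairs_uniq => // -[? ?] [? ?] /=.
have term0 t pq : pq \notin r -> ext_term phi (cten x y) t pq = 0.
  rewrite ext_term_cten //; case: pq => p q /= pqr.
  have [ps|/xs ->] := boolP (p \in s); last by rewrite inj0 phi0l.
  have [qs|/ys ->] := boolP (q \in s'); last by rewrite inj0 phi0r.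
  by case/negP: pqr; apply: allpairs_f.
split=> [t|].
  apply: (sub_finite_set (B := [set` r])); last exact: finite_seq.
  by move=> pq /= pq0; apply: contraT => /term0 E; rewrite E eqxx in pq0.
apply: functional_extensionality_dep => t.
rewrite /ext (fsbigE r) //; last by move=> pq _; apply: term0.
under eq_bigl do rewrite in_setT.
pose Fl z := HB.pack_for {linear dsum U -> cprod W} (phi ^~ z)
  (GRing.isLinear.Build _ _ _ _ (phi ^~ z) (br z)).
pose Fr z := HB.pack_for {linear dsum V -> cprod W} (phi z)
  (GRing.isLinear.Build _ _ _ _ (phi z) (bl z)).
have csumE (J : Type) (l : seq J) (g : J -> cprod W) :
    (\sum_(j <- l) g j) t = \sum_(j <- l) g j t.
  by elim/big_rec2: _ => // j z z' _ <-.
rewrite big_allpairs {2}(dsum_decomp us xs) -[phi _ y]/(Fl y _) linear_sum csumE.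
apply: eq_bigr => p _ /=; rewrite {2}(dsum_decomp us' ys).
rewrite -[phi (inj (x p)) _]/(Fr _ _) linear_sum csumE.
by apply: eq_bigr => q _; rewrite ext_term_cten.
Qed.

Definition cmap U V U' V' (f : dsum U -> dsum U') (g : dsum V -> dsum V') :
    ctens U V -> ctens U' V' :=
  ext (fun x y => cten (f x) (g y)).

Definition cswap U V (s : ctens U V) : ctens V U :=
  fun t => swap (s (t.2, t.1)).

Definition cswap12 U V W (s : ctens3 U V W) : ctens3 V U W :=
  fun t => tmap (@swap K _ _) idfun (s (t.1.2, t.1.1, t.2)).

End Completed.

Section PreLie.
Variables (K : fieldType) (L : int -> vectType K).
Variable mul : dsum L -> dsum L -> dsum L.
Implicit Types (a b c x y : dsum L) (r s : ctens L L).

Definition lie x y := mul x y - mul y x.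

Definition pre_lie : Prop :=
  is_bilinear mul /\
  forall x y z, mul (mul x y) z - mul x (mul y z)
              = mul (mul y x) z - mul y (mul x z).

Section Coalgebra.
Variable delta : dsum L -> ctens L L.

Definition id_delta x y : ctens3 L L L :=
  fun t => tlift (fun v w => x t.1.1 ⊗ v ⊗ w) (delta y (t.1.2, t.2)).

Definition delta_id x y : ctens3 L L L := fun t => delta x t.1 ⊗ y t.2.

Definition completed_pre_lie_coalgebra : Prop :=
  [/\ linear delta,
      forall x, extendable id_delta (delta x) /\
                extendable delta_id (delta x) &
      forall x,
        let I_delta : ctens3 L L L := ext id_delta (delta x) in
        let delta_I : ctens3 L L L := ext delta_id (delta x) in
        I_delta - cswap12 I_delta = delta_I - cswap12 delta_I].

(* [L] is required to be a graded pre-Lie algebra: this is what makes the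
   termwise extensions [cmap] of multiplication operators finite in each
   component. *)
Definition completed_pre_lie_bialgebra : Prop :=
  let antisym x : ctens L L := delta x - cswap (delta x) in
  [/\ pre_lie, graded_mul mul, completed_pre_lie_coalgebra,
      forall a b,
        antisym (mul a b)
        - cmap (mul a) idfun (antisym b)
        - cmap idfun (mul a) (antisym b)
        - cmap idfun (mul ^~ b) (delta a)
        + cmap (mul ^~ b) idfun (cswap (delta a)) = 0 &
      forall a b,
        delta (mul a b - mul b a)
        - cmap idfun (fun y => mul y b - mul b y) (delta a)
        - cmap idfun (fun y => mul a y - mul y a) (delta b)
        - cmap (mul a) idfun (delta b)
        + cmap (mul b) idfun (delta a) = 0].

End Coalgebra.

Definition S_elem a b a' b' : ctens3 L L L :=
  cten3 (mul a a') b b' - cten3 a (mul b a') b' - cten3 a a' (lie b b').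

Definition S_term r (t : int * int * int) (ij : (int * int) * (int * int)) :=
  tlift (fun ai bi => tlift (fun aj bj =>
    S_elem (inj ai) (inj bi) (inj aj) (inj bj) t) (r ij.2)) (r ij.1).

(* The left-hand side is a formal sum over pairs of terms of [r]; being a
   solution includes that each of its components is a finite sum. *)
Definition completed_S_solution r : Prop :=
  forall t, finite_set [set ij | S_term r t ij != 0] /\
    \sum_(ij \in [set: (int * int) * (int * int)]) S_term r t ij = 0.

Definition ad_op x s : ctens L L :=
  cmap (mul x) idfun s + cmap idfun (fun y => mul x y - mul y x) s.

Definition completed_invariant s : Prop := forall x, ad_op x s = 0.

Definition delta_r r x : ctens L L := - ad_op x r.

Definition completed_quasi_triangular r : Prop :=
  [/\ completed_pre_lie_bialgebra (delta_r r),
      completed_S_solution r & completed_invariant (r - cswap r)].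

Definition completed_triangular r : Prop :=
  completed_quasi_triangular r /\ cswap r = r.

End PreLie.

Section Affinization.
Variables (K : fieldType) (A : vectType K) (B : int -> vectType K).

(* [dsum AB] is [A ⊗ B], with [A] in degree 0. *)
Definition AB (i : int) : vectType K := tens A (B i).

Fact finsupp_tensA (a : A) (x : dsum B) :
  finsupp ((fun i => a ⊗ x i) : cprod AB).
Proof.
case: x => x /= /asboolP fx; apply/asboolP; apply: sub_finite_set fx => i /=.
apply: contraNneq => ->; apply/eqP/matrixP => k l.
by rewrite !mxE linear0 mulr0.
Qed.

Definition tensA (a : A) (x : dsum B) : dsum AB := DSum (finsupp_tensA a x).

(* the linear map on [A ⊗ B] induced by a bilinear map *)
Definition liftA (W : lmodType K) (F : A -> dsum B -> W) (X : dsum AB) : W :=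
  \sum_(i \in [set: int]) tlift (fun a v => F a (inj v)) (X i).

Definition AB_mul (succ prec : A -> A -> A) (dia : dsum B -> dsum B -> dsum B)
    (X Y : dsum AB) : dsum AB :=
  liftA (fun a x => liftA (fun b y =>
    tensA (succ a b) (dia x y) - tensA (prec b a) (dia y x)) Y) X.

Lemma tensA_bilinear : is_bilinear tensA.
Proof.
have tb i := @tensv_bilinear K A (B i).
split=> [a c x y|x c a b]; apply: dsumP => i; rewrite componentD componentZ.
  by rewrite [LHS](proj1 (tb i)).
by rewrite [LHS](proj2 (tb i)).
Qed.

Lemma liftAE (W : lmodType K) (F : A -> dsum B -> W) (X : dsum AB) s :
  uniq s -> (forall i, i \notin s -> X i = 0) ->
  liftA F X = \sum_(i <- s) tlift (fun a v => F a (inj v)) (X i).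
Proof.
move=> us Xs; rewrite /liftA (fsbigE s) //; last first.
  by move=> i _ /Xs ->; exact: linear_at0 (tlift_linear _).
by under eq_bigl do rewrite in_setT.
Qed.

Lemma liftA_linear (W : lmodType K) (F : A -> dsum B -> W) : linear (liftA F).
Proof.
move=> c X Y; have [s us Xs] := dsum_support X.
have [s' us' Ys] := dsum_support Y.
have [X0 Y0] : (forall i, i \notin undup (s ++ s') -> X i = 0) /\
    (forall i, i \notin undup (s ++ s') -> Y i = 0).
  by split=> i; rewrite mem_undup mem_cat negb_or => /andP[? ?]; auto.
have Z0 : forall i, i \notin undup (s ++ s') -> (c *: X + Y) i = 0.
  by move=> i si; rewrite componentD componentZ X0 // Y0 // scaler0 addr0.
have us2 := undup_uniq (s ++ s').
rewrite (liftAE F us2 Z0) (liftAE F us2 X0) (liftAE F us2 Y0).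
rewrite scaler_sumr -big_split; apply: eq_bigr => i _.
by rewrite componentD componentZ [LHS]tlift_linear.
Qed.

Lemma liftA_linear_fun (W : lmodType K) (F F1 F2 : A -> dsum B -> W) c X :
  (forall a x, F a x = c *: F1 a x + F2 a x) ->
  liftA F X = c *: liftA F1 X + liftA F2 X.
Proof.
move=> FE; have [s us Xs] := dsum_support X; rewrite !(liftAE _ us Xs).
rewrite scaler_sumr -big_split; apply: eq_bigr => i _ /=; rewrite /tlift.
rewrite scaler_sumr -big_split; apply: eq_bigr => j _ /=.
rewrite scaler_sumr -big_split; apply: eq_bigr => k _ /=.
by rewrite FE scalerDr !scalerA [c * _]mulrC.
Qed.

Lemma liftA_tensA (W : lmodType K) (F : A -> dsum B -> W) a x :
  is_bilinear F -> liftA F (tensA a x) = F a x.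
Proof.
move=> [bl br]; have [s us xs] := dsum_support x.
have E i : tlift (fun a v => F a (inj v)) (tensA a x i) = F a (inj (x i)).
  rewrite [tensA a x i]/(a ⊗ x i) tlift_tensv //; split=> [b|v] c w w'.
    by rewrite inj_linear bl.
  exact: br.
have F0 : F a 0 = 0 := linear_at0 (bl a).
have inj0 i : @inj K B i 0 = 0 := linear_at0 (@inj_linear K B i).
rewrite /liftA (fsbigE s) //; last by move=> i _ /xs xi; rewrite E xi inj0.
under eq_bigl do rewrite in_setT.
pose G := HB.pack_for {linear dsum B -> W} (F a)
  (GRing.isLinear.Build _ _ _ _ (F a) (bl a)).
rewrite [in RHS](dsum_decomp us xs) -[RHS]/(G _) linear_sum.
by apply: eq_bigr => i _; rewrite E.
Qed.

Lemma AB_mul_tensA succ prec dia a b x y :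
  is_bilinear succ -> is_bilinear prec -> is_bilinear dia ->
  AB_mul succ prec dia (tensA a x) (tensA b y)
  = tensA (succ a b) (dia x y) - tensA (prec b a) (dia y x).
Proof.
have expand (U V W : lmodType K) (g : U -> V -> W) : is_bilinear g ->
    (forall u c v w, g u (c *: v + w) = c *: g u v + g u w) /\
    (forall v c u w, g (c *: u + w) v = c *: g u v + g w v).
  by move=> [gl gr]; split=> ? ? ? ?; [apply: gl | apply: gr].
move=> /expand[sl sr] /expand[pl pr] /expand[dl dr].
have [tl tr] := expand _ _ _ _ tensA_bilinear.
rewrite /AB_mul liftA_tensA.
  rewrite liftA_tensA //; split=> [b'|y'] c w w' /=.
    by rewrite dl dr !tl scalerBr opprD addrACA.
  by rewrite sl pr !tr scalerBr opprD addrACA.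
split=> [a'|x'] c w w' /=; apply: liftA_linear_fun => b' y'.
  by rewrite dr dl !tl scalerBr opprD addrACA.
by rewrite sr pl !tr scalerBr opprD addrACA.
Qed.

Definition rhat (n : nat) (u v : 'I_n -> A)
    (Omega : choiceType) (e f : Omega -> dsum B) : ctens AB AB :=
  \sum_(i < n) csum (fun j => cten (tensA (u i) (e j)) (tensA (v i) (f j))).

End Affinization.

(* Main.v *)
(* Everything is tested against the graded dual of L (linear functionals
   vanishing on almost all components), which separates the points of L and of
   its completed tensor powers. A formal tensor r of total degree d contracts
   with a functional to honest elements rho(psi) = (id ⊗ psi) r and
   rho'(phi) = (phi ⊗ id) r of L, so no infinite sum survives. In these terms the
   S-equation and the invariance of r - tau(r) read
     phi(rho psi . rho chi) = psi(rho' phi . rho chi) + chi([rho' phi, rho' psi]),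
     phi(x . D psi) = psi([x, D phi])            with D = rho - rho',
   delta_r is dual to the product
     (phi * psi)(x) = - phi(x . rho psi) - psi([x, rho' phi]),
   and the two identities make rho and rho' anti-homomorphisms for *, from which
   the pre-Lie identity of * and both compatibility conditions follow.

   For L = A ⊗ B the graded dual is spanned by the functionals
   alpha ⊗ omega(y, -), on which the contractions of the affinization of r are
   those of r: beta ⊗ omega(y, -) goes to (id ⊗ beta) r ⊗ y under rho, and
   alpha ⊗ omega(y, -) to - (alpha ⊗ id) r ⊗ y under rho'. The invariance of
   omega expresses all values omega(_, _ ⋄ _) through the two scalars
   omega(x, y ⋄ z) and omega(x, z ⋄ y); the coefficient of the first is the
   LD-YBE, that of the second vanishes by the LD-YBE and the invariance of
   r + tau(r). *)

Require Import Defs.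
From HB Require Import structures.
From mathcomp Require Import all_boot all_order all_algebra.
From mathcomp Require Import boolp classical_sets functions cardinality fsbigop.
From mathcomp Require Import ring.
(* [functions] also exports a constant named [inj]. *)
Import Defs.

Set Implicit Arguments.
Unset Strict Implicit.
Unset Printing Implicit Defensive.

Import GRing.Theory.

Local Open Scope ring_scope.

(** * Testing finite tensors *)

Section TensorCalculus.
Variable K : fieldType.
Implicit Types U V W : vectType K.

Lemma linear_tlift U V (W W' : lmodType K) (b : U -> V -> W) (h : W -> W') s :
  linear h -> h (tlift b s) = tlift (fun u v => h (b u v)) s.
Proof.
move=> hl; pose H := HB.pack_for {linear W -> W'} h
  (GRing.isLinear.Build _ _ _ _ h hl).
rewrite -[LHS]/(H _) linear_sum; apply: eq_bigr => i _.
by rewrite linear_sum; apply: eq_bigr => j _; rewrite linearZ.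
Qed.

Lemma eq_tlift U V (W : lmodType K) (b b' : U -> V -> W) :
  (forall u v, b u v = b' u v) -> tlift b =1 tlift b'.
Proof.
by move=> bb' s; apply: eq_bigr => i _; apply: eq_bigr => j _; rewrite bb'.
Qed.

Lemma tlift0 U V (W : lmodType K) (b : U -> V -> W) :
  tlift b 0 = 0.
Proof. exact: linear_at0 (tlift_linear b). Qed.

Lemma tlift_eq0 U V (W : lmodType K) (b : U -> V -> W) s :
  (forall u v, b u v = 0) -> tlift b s = 0.
Proof.
by move=> b0; apply: big1 => i _; apply: big1 => j _; rewrite b0 scaler0.
Qed.

Lemma tliftP U V (W : lmodType K) c (b b' : U -> V -> W) s :
  tlift (fun u v => c *: b u v + b' u v) s = c *: tlift b s + tlift b' s.
Proof.
rewrite scaler_sumr -big_split; apply: eq_bigr => i _ /=.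
rewrite scaler_sumr -big_split; apply: eq_bigr => j _ /=.
by rewrite scalerDr !scalerA [c * _]mulrC.
Qed.

Lemma tliftZ U V (W : lmodType K) c (b : U -> V -> W) s :
  tlift (fun u v => c *: b u v) s = c *: tlift b s.
Proof.
rewrite -[RHS]addr0 -[in RHS](@tlift_eq0 _ _ W (fun _ _ => 0) s) // -tliftP.
by apply: eq_tlift => u v; rewrite addr0.
Qed.

Lemma tliftB U V (W : lmodType K) (b b' : U -> V -> W) s :
  tlift (fun u v => b u v - b' u v) s = tlift b s - tlift b' s.
Proof.
rewrite addrC -scaleN1r -tliftP; apply: eq_tlift => u v.
by rewrite scaleN1r addrC.
Qed.

Lemma tlift_sum U V (W : lmodType K) (J : Type) (F : seq J)
    (b : J -> U -> V -> W) s :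
  tlift (fun u v => \sum_(k <- F) b k u v) s = \sum_(k <- F) tlift (b k) s.
Proof.
elim: F => [|k F IH].
  by rewrite big_nil; apply: tlift_eq0 => u v; rewrite big_nil.
rewrite big_cons -IH -[X in X + _]scale1r -tliftP; apply: eq_tlift => u v.
by rewrite big_cons scale1r.
Qed.

Definition test2 U V (lam : U -> K^o) (mu : V -> K^o) : tens U V -> K^o :=
  tlift (fun u v => lam u * mu v : K^o).

Lemma test2_linear U V (lam : U -> K^o) (mu : V -> K^o) :
  linear (test2 lam mu).
Proof. exact: tlift_linear. Qed.

Lemma is_bilinearM (U V : lmodType K) (lam : U -> K^o) (mu : V -> K^o) :
  linear lam -> linear mu ->
  is_bilinear (fun u v => lam u * mu v : K^o).
Proof.
move=> ll lm; split=> [u c v v'|v c u u'] /=.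
  by rewrite lm mulrDr; congr (_ + _); rewrite -[_ *: _]/(_ * _) mulrCA.
by rewrite ll mulrDl; congr (_ + _); rewrite -[_ *: _]/(_ * _) -mulrA.
Qed.

Lemma test2_tens U V (lam : U -> K^o) (mu : V -> K^o) u v :
  linear lam -> linear mu -> test2 lam mu (u ⊗ v) = lam u * mu v.
Proof. by move=> ll lm; rewrite /test2 tlift_tensv //; apply: is_bilinearM. Qed.

(** Each matrix entry is itself such a test, taken at the coordinate forms of the two bases. *)
Lemma tens_ext U V (s s' : tens U V) :
  (forall (lam : U -> K^o) (mu : V -> K^o), linear lam -> linear mu ->
     test2 lam mu s = test2 lam mu s') -> s = s'.
Proof.
move=> ss'; apply/matrixP => i j.
have E (t : tens U V) :
    t i j = test2 (coord (vbasis {:U}) i) (coord (vbasis {:V}) j) t.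
  apply: (@tlift_uniq K U V K^o (fun t : tens U V => t i j)) => [a t1 t2||u v].
  - by rewrite !mxE.
  - exact: tlift_linear.
  by rewrite mxE test2_tens // => a x y; rewrite linearP.
by rewrite !E ss' // => a x y; rewrite linearP.
Qed.

Definition test3 U V W (lam : U -> K^o) (mu : V -> K^o) (nu : W -> K^o) :
    tens (tens U V) W -> K^o :=
  tlift (fun w z => test2 lam mu w * nu z : K^o).

Lemma test3_linear U V W (lam : U -> K^o) (mu : V -> K^o) (nu : W -> K^o) :
  linear (test3 lam mu nu).
Proof. exact: tlift_linear. Qed.

Lemma test3_tens U V W lam mu nu (u : U) (v : V) (w : W) :
  linear lam -> linear mu -> linear nu ->
  test3 lam mu nu (u ⊗ v ⊗ w) = lam u * mu v * nu w.
Proof.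
move=> ll lm ln; rewrite /test3 tlift_tensv; last first.
  by apply: is_bilinearM => //; apply: test2_linear.
by rewrite test2_tens.
Qed.

(** Rows are indexed by the basis of [tens U V], whose coordinate forms need not be products
    [lam ⊗ mu]. The factor [W] is therefore contracted first: [col] is the [j]-th column read as an
    element of [tens U V], and [tens_ext] applies to it. *)
Lemma test3_ext U V W (s s' : tens (tens U V) W) :
  (forall lam mu nu, linear lam -> linear mu -> linear nu ->
     test3 lam mu nu s = test3 lam mu nu s') -> s = s'.
Proof.
move=> ss'; apply/matrixP => k j.
pose col (t : tens (tens U V) W) : tens U V :=
  \sum_i t i j *: (vbasis {:tens U V})`_i.
have colE (t : tens (tens U V) W) : col t = tlift (fun w z =>
    coord (vbasis {:W}) j z *: w) t.
  rewrite /tlift; apply: eq_bigr => i _.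
  rewrite (bigD1 j) //= big1 => [|l lj]; last first.
    by rewrite coord_free ?(basis_free (vbasisP _)) // (negPf lj) scale0r scaler0.
  by rewrite coord_free ?(basis_free (vbasisP _)) // eqxx scale1r addr0.
have cl : col s = col s'.
  apply: tens_ext => lam mu ll lm; rewrite !colE.
  have tl := test2_linear lam mu.
  rewrite !(linear_tlift _ _ tl).
  have := ss' lam mu (coord (vbasis {:W}) j) ll lm.
  have E t : test3 lam mu (coord (vbasis {:W}) j) t = tlift (fun w z =>
     test2 lam mu (coord (vbasis {:W}) j z *: w)) t.
    apply: eq_tlift => w z.
    have := tl (coord (vbasis {:W}) j z) w 0.
    by rewrite (linear_at0 tl) !addr0 => ->; apply: mulrC.
  by rewrite !E; apply=> a x y; rewrite linearP.
have E (t : tens (tens U V) W) : t k j = coord (vbasis {:tens U V}) k (col t).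
  rewrite /col linear_sum /= (bigD1 k) //= big1 => [|l lk]; last first.
    by rewrite linearZ /= coord_free ?(basis_free (vbasisP _)) // (negPf lk) mulr0.
  by rewrite linearZ /= coord_free ?(basis_free (vbasisP _)) // eqxx mulr1 addr0.
by rewrite !E cl.
Qed.

Lemma test2_swap U V (lam : U -> K^o) (mu : V -> K^o) s :
  linear lam -> linear mu -> test2 mu lam (swap s) = test2 lam mu s.
Proof.
move=> ll lm; rewrite /swap (linear_tlift _ _ (test2_linear _ _)).
by apply: eq_tlift => u v; rewrite test2_tens // mulrC.
Qed.

Lemma test3_swap U V W (lam : U -> K^o) (mu : V -> K^o) (nu : W -> K^o)
    (s : tens (tens U V) W) :
  linear lam -> linear mu -> linear nu ->
  test3 mu lam nu (tmap (@swap K U V) idfun s) = test3 lam mu nu s.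
Proof.
move=> ll lm ln; rewrite /tmap (linear_tlift _ _ (test3_linear _ _ _)).
apply: eq_tlift => w z; rewrite /test3 tlift_tensv; last first.
  by apply: is_bilinearM => //; apply: test2_linear.
by rewrite test2_swap.
Qed.

End TensorCalculus.

(** * The graded dual *)

Section GradedDual.
Variable K : fieldType.
Implicit Types L : int -> vectType K.

Lemma fsbig_cover (W : nmodType) (T : choiceType) (N : seq T) (F : T -> W) :
  uniq N -> (forall i, i \notin N -> F i = 0) ->
  \sum_(i \in [set: T]) F i = \sum_(i <- N) F i.
Proof.
move=> uN F0; rewrite (fsbigE N) //; last by move=> i _; apply: F0.
by under eq_bigl do rewrite in_setT.
Qed.

Section Linear.
Variables (U V : lmodType K) (f : U -> V).
Hypothesis fl : linear f.

Let F := HB.pack_for {linear U -> V} f (GRing.isLinear.Build _ _ _ _ f fl).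

Lemma lin0 : f 0 = 0. Proof. exact: (linear0 F). Qed.
Lemma linN : {morph f : x / - x}. Proof. exact: (linearN F). Qed.
Lemma linD : {morph f : x y / x + y}. Proof. exact: (linearD F). Qed.
Lemma linB : {morph f : x y / x - y}. Proof. exact: (linearB F). Qed.
Lemma linZ c : {morph f : x / c *: x}. Proof. exact: (linearZ_LR F c). Qed.
Lemma lin_sum J (s : seq J) (x : J -> U) :
  f (\sum_(j <- s) x j) = \sum_(j <- s) f (x j).
Proof. exact: (linear_sum F). Qed.

End Linear.

Definition gdual L (phi : dsum L -> K^o) : Prop :=
  linear phi /\
  exists S : seq int, forall i, i \notin S -> forall v : L i, phi (inj v) = 0.

(** Each component of the output depends on finitely many components of the input. This makes the
    transpose of [f] preserve the graded dual and its termwise extension finite in every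
    component. *)
Definition continuous L L' (f : dsum L -> dsum L') : Prop :=
  linear f /\
  forall p, exists S : seq int,
    forall i, i \notin S -> forall v : L i, f (inj v) p = 0.

Lemma inj0 L i : @inj K L i 0 = 0. Proof. exact: lin0 (@inj_linear _ _ _). Qed.

Lemma gdual_eq0 L (x : dsum L) :
  (forall phi, gdual phi -> phi x = 0) -> x = 0.
Proof.
move=> x0; apply: dsumP => p.
rewrite (coord_vbasis (memvf (x p))); apply: big1 => k _.
suff -> : coord (vbasis {:L p}) k (x p) = 0 by rewrite scale0r.
apply: (x0 (fun y : dsum L => coord (vbasis {:L p}) k (y p))); split.
  by move=> a y z; rewrite componentD componentZ linearP.
by exists [:: p] => i; rewrite inE => ip v; rewrite inj_out // linear0.
Qed.

Lemma gdual_eq L (x y : dsum L) :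
  (forall phi, gdual phi -> phi x = phi y) -> x = y.
Proof.
move=> xy; apply/eqP; rewrite -subr_eq0; apply/eqP/gdual_eq0 => phi dphi.
by rewrite (linB (proj1 dphi)) xy // subrr.
Qed.

Lemma gdual_supp L (phi : dsum L -> K^o) : gdual phi ->
  exists2 S : seq int, uniq S &
    forall i, i \notin S -> forall v : L i, phi (inj v) = 0.
Proof.
case=> _ [S S0]; exists (undup S); first exact: undup_uniq.
by move=> i; rewrite mem_undup; apply: S0.
Qed.

Lemma gdualE L (phi : dsum L -> K^o) S x : linear phi -> uniq S ->
  (forall i, i \notin S -> forall v : L i, phi (inj v) = 0) ->
  phi x = \sum_(i <- S) phi (inj (x i)).
Proof.
move=> lphi uS S0; have [T uT x0] := dsum_support x.
rewrite {1}(dsum_decomp uT x0) lin_sum //.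
rewrite -(fsbig_cover uT) => [|i /x0 ->]; last by rewrite inj0 lin0.
by rewrite -(fsbig_cover uS) // => i /S0.
Qed.

Lemma continuous_cover L L' (f : dsum L -> dsum L') (P : seq int) :
  continuous f -> exists2 S : seq int, uniq S &
    forall i, i \notin S -> forall (v : L i) p, p \in P -> f (inj v) p = 0.
Proof.
move=> [fl fc]; elim: P => [|p P [S _ S0]]; first by exists [::].
have [T T0] := fc p; exists (undup (S ++ T)); first exact: undup_uniq.
move=> i; rewrite mem_undup mem_cat negb_or => /andP[iS iT] v q.
by rewrite inE => /predU1P[->|]; [apply: T0 | apply: S0].
Qed.

Lemma gdual_comp L L' (f : dsum L -> dsum L') (phi : dsum L' -> K^o) :
  gdual phi -> continuous f -> gdual (fun x => phi (f x)).
Proof.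
move=> dphi fc; have [lphi _] := dphi; have [T uT T0] := gdual_supp dphi.
have [S uS S0] := continuous_cover T fc.
split=> [a x y|]; first by rewrite (proj1 fc) lphi.
exists S => i /S0 fi v; rewrite (gdualE _ lphi uT T0) big1_seq // => p /andP[_ pT].
by rewrite fi // inj0 lin0.
Qed.

Lemma gdualP L c (phi psi : dsum L -> K^o) :
  gdual phi -> gdual psi -> gdual (fun x => c *: phi x + psi x).
Proof.
move=> [lphi [S S0]] [lpsi [T T0]]; split=> [a x y|].
  by rewrite lphi lpsi !scalerDr !scalerA [c * a]mulrC addrACA.
exists (S ++ T) => i; rewrite mem_cat negb_or => /andP[iS iT] v.
by rewrite S0 // T0 // scaler0 addr0.
Qed.

Lemma gdual0 L : gdual (fun _ : dsum L => 0 : K^o).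
Proof. by split=> [a x y|]; [rewrite scaler0 addr0|exists [::]]. Qed.

Lemma gdualD L (phi psi : dsum L -> K^o) :
  gdual phi -> gdual psi -> gdual (fun x => phi x + psi x).
Proof.
move=> dphi dpsi; have := gdualP 1 dphi dpsi.
by under [X in gdual X]eq_fun do rewrite scale1r.
Qed.

Lemma gdualN L (phi : dsum L -> K^o) : gdual phi -> gdual (fun x => - phi x).
Proof.
move=> dphi; have := gdualP (-1) dphi (gdual0 L).
by under [X in gdual X]eq_fun do rewrite scaleN1r addr0.
Qed.

Lemma gdualB L (phi psi : dsum L -> K^o) :
  gdual phi -> gdual psi -> gdual (fun x => phi x - psi x).
Proof. by move=> dphi /gdualN; apply: gdualD. Qed.

Lemma gdual_sum L (J : Type) (s : seq J) (phi : J -> dsum L -> K^o) :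
  (forall j, gdual (phi j)) -> gdual (fun x => \sum_(j <- s) phi j x).
Proof.
move=> dphi; elim: s => [|j s IH].
  by under [X in gdual X]eq_fun do rewrite big_nil; apply: gdual0.
by under [X in gdual X]eq_fun do rewrite big_cons; apply: gdualD.
Qed.

Lemma gdual_conc L p (lam : L p -> K^o) :
  linear lam -> gdual (fun x : dsum L => lam (x p)).
Proof.
move=> ll; split=> [a x y|]; first by rewrite componentD componentZ ll.
by exists [:: p] => i; rewrite inE => ip v; rewrite inj_out // lin0.
Qed.

Lemma gdual_inj L (phi : dsum L -> K^o) i :
  gdual phi -> linear (fun v : L i => phi (inj v)).
Proof. by move=> [lphi _] a v w; rewrite inj_linear lphi. Qed.

(** The value of [phi ⊗ psi] on a formal sum. For functionals in the graded dual only finitely many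
    bidegrees contribute, so it is meaningful on the whole completion. *)
Definition pair L L' (phi : dsum L -> K^o) (psi : dsum L' -> K^o)
    (s : ctens L L') : K^o :=
  \sum_(pq \in [set: int * int])
    test2 (fun u => phi (inj u)) (fun v => psi (inj v)) (s pq).

Lemma test2_eq0l (U V : vectType K) (lam : U -> K^o) (mu : V -> K^o) s :
  (forall u, lam u = 0) -> test2 lam mu s = 0.
Proof. by move=> l0; apply: tlift_eq0 => u v; rewrite l0 mul0r. Qed.

Lemma test2_eq0r (U V : vectType K) (lam : U -> K^o) (mu : V -> K^o) s :
  (forall u, mu u = 0) -> test2 lam mu s = 0.
Proof. by move=> l0; apply: tlift_eq0 => u v; rewrite l0 mulr0. Qed.

Lemma pair_coverE L L' (phi : dsum L -> K^o) (psi : dsum L' -> K^o) S T s :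
  uniq S -> uniq T ->
  (forall i, i \notin S -> forall v : L i, phi (inj v) = 0) ->
  (forall i, i \notin T -> forall v : L' i, psi (inj v) = 0) ->
  pair phi psi s = \sum_(p <- S) \sum_(q <- T)
    test2 (fun u => phi (inj u)) (fun v => psi (inj v)) (s (p, q)).
Proof.
move=> uS uT S0 T0; rewrite /pair (@fsbig_cover _ _ [seq (p, q) | p <- S, q <- T]).
- by rewrite big_allpairs.
- by apply: allpairs_uniq => // -[? ?] [? ?] /=.
case=> p q pq; have [pS|pS] := boolP (p \in S); last first.
  by apply: test2_eq0l => u; rewrite S0.
have [qT|qT] := boolP (q \in T); last by apply: test2_eq0r => u; rewrite T0.
by case/negP: pq; apply: allpairs_f.
Qed.

Lemma pair_linear L L' (phi : dsum L -> K^o) (psi : dsum L' -> K^o) :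
  gdual phi -> gdual psi -> linear (pair phi psi).
Proof.
move=> /gdual_supp[S uS S0] /gdual_supp[T uT T0] a s s'.
rewrite !(pair_coverE _ uS uT S0 T0) scaler_sumr -big_split.
apply: eq_bigr => p _ /=; rewrite scaler_sumr -big_split.
by apply: eq_bigr => q _ /=; rewrite -test2_linear.
Qed.

Lemma pair_swap L L' (phi : dsum L -> K^o) (psi : dsum L' -> K^o) s :
  gdual phi -> gdual psi -> pair psi phi (cswap s) = pair phi psi s.
Proof.
move=> dphi dpsi.
have [S uS S0] := gdual_supp dphi; have [T uT T0] := gdual_supp dpsi.
rewrite (pair_coverE _ uS uT S0 T0) (pair_coverE _ uT uS T0 S0) exchange_big.
apply: eq_bigr => p _; apply: eq_bigr => q _.
by rewrite /cswap test2_swap //; apply: gdual_inj.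
Qed.

Lemma pair_conc L L' p q (lam : L p -> K^o) (mu : L' q -> K^o) s :
  linear lam -> linear mu ->
  pair (fun x : dsum L => lam (x p)) (fun y : dsum L' => mu (y q)) s
  = test2 lam mu (s (p, q)).
Proof.
move=> ll lm; rewrite (@pair_coverE _ _ _ _ [:: p] [:: q]) //.
- by rewrite !big_seq1; apply: eq_tlift => u v; rewrite !inj_in.
- by move=> i; rewrite inE => ip v; rewrite inj_out // lin0.
- by move=> i; rewrite inE => ip v; rewrite inj_out // lin0.
Qed.

Lemma pair_ext L L' (s s' : ctens L L') :
  (forall phi psi, gdual phi -> gdual psi -> pair phi psi s = pair phi psi s') ->
  s = s'.
Proof.
move=> ss'; apply: cprodP => -[p q]; apply: tens_ext => lam mu ll lm.
by rewrite -!pair_conc // ss' //; apply: gdual_conc.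
Qed.

(** * Termwise extensions under linear functionals *)

Section Ext.
Variables (L L' : int -> vectType K) (T : Type) (W : T -> vectType K).
Variables (b : dsum L -> dsum L' -> cprod W) (t : T) (N : seq (int * int)).
Hypothesis N0 : forall p q, (p, q) \notin N ->
  forall (u : L p) (v : L' q), b (inj u) (inj v) t = 0.

Let term0 s pq : pq \notin undup N -> ext_term b s t pq = 0.
Proof.
by case: pq => p q; rewrite mem_undup => /N0 b0; apply: tlift_eq0.
Qed.

Lemma extendable_cover s : finite_set [set pq | ext_term b s t pq != 0].
Proof.
apply: (sub_finite_set (B := [set` undup N])); last exact: finite_seq.
by move=> pq /= pq0; apply: contraT => /term0 E; rewrite E eqxx in pq0.
Qed.

Lemma linear_ext (h : W t -> K^o) s : linear h ->
  h (ext b s t) = \sum_(pq \in [set: int * int])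
    tlift (fun (u : L pq.1) (v : L' pq.2) => h (b (inj u) (inj v) t)) (s pq).
Proof.
move=> hl; have uN := undup_uniq N.
rewrite /ext (fsbig_cover uN) ?(fsbig_cover uN).
- by rewrite lin_sum //; apply: eq_bigr => pq _; rewrite /ext_term linear_tlift.
- by move=> pq /(@term0 s) E; rewrite -(linear_tlift _ _ hl) [X in h X]E lin0.
- exact: term0.
Qed.

End Ext.

Lemma tens0l (U V : vectType K) (v : V) : (0 : U) ⊗ v = 0.
Proof. exact: (lin0 (proj2 (@tensv_bilinear K U V) v)). Qed.

Lemma tens0r (U V : vectType K) (u : U) : u ⊗ (0 : V) = 0.
Proof. exact: (lin0 (proj1 (@tensv_bilinear K U V) u)). Qed.

(** By continuity, only a finite list [N] of bidegrees of [s] reaches the supports [S], [T] of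
    [phi], [psi]. Both sides thus become finite sums over [S], [T] and [N], and the summations are
    exchanged. *)
Lemma pair_cmap L1 L2 L1' L2' (f : dsum L1 -> dsum L1')
    (g : dsum L2 -> dsum L2') phi psi s :
  gdual phi -> gdual psi -> continuous f -> continuous g ->
  pair phi psi (cmap f g s) = pair (fun x => phi (f x)) (fun y => psi (g y)) s.
Proof.
move=> dphi dpsi fc gc.
have [S uS S0] := gdual_supp dphi; have [T uT T0] := gdual_supp dpsi.
have [A uA A0] := continuous_cover S fc; have [B uB B0] := continuous_cover T gc.
pose N := [seq (a, b) | a <- A, b <- B].
have uN : uniq N by apply: allpairs_uniq => // -[? ?] [? ?] /=.
have N0 a b : (a, b) \notin N -> a \notin A \/ b \notin B.
  move=> abN; have [aA|] := boolP (a \in A); last by left.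
  have [bB|] := boolP (b \in B); last by right.
  by case/negP: abN; apply: allpairs_f.
have E p q : p \in S -> q \in T ->
    test2 (fun u => phi (inj u)) (fun v => psi (inj v)) (cmap f g s (p, q))
    = \sum_(ab <- N) tlift (fun (u : L1 ab.1) (v : L2 ab.2) =>
        phi (inj (f (inj u) p)) * psi (inj (g (inj v) q)) : K^o) (s ab).
  move=> pS qT; rewrite (@linear_ext _ _ _ _ _ (p, q) N).
  - rewrite (fsbig_cover uN) => [|[a b] /N0 N0ab].
      apply: eq_bigr => ab _; apply: eq_tlift => u v.
      by rewrite test2_tens //; apply: gdual_inj.
    apply: tlift_eq0 => u v; rewrite test2_tens /=; try exact: gdual_inj.
    case: N0ab => [/A0 ->|/B0 ->] //; first by rewrite inj0 (lin0 (proj1 dphi)) mul0r.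
    by rewrite inj0 (lin0 (proj1 dpsi)) mulr0.
  - move=> a b /N0 N0ab u v; rewrite /cten /=.
    by case: N0ab => [/A0 ->|/B0 ->] //; rewrite ?tens0l ?tens0r.
  - exact: test2_linear.
rewrite (pair_coverE _ uS uT S0 T0).
under eq_big_seq => p pS do
  (under eq_big_seq => q qT do rewrite E //; rewrite exchange_big).
rewrite exchange_big /= /pair (fsbig_cover uN) => [|[a b] /N0 N0ab]; last first.
  case: N0ab => N0ab; [apply: test2_eq0l => u | apply: test2_eq0r => u].
    rewrite (gdualE _ (proj1 dphi) uS S0) big1_seq // => p pS.
    by rewrite A0 // inj0 (lin0 (proj1 dphi)).
  rewrite (gdualE _ (proj1 dpsi) uT T0) big1_seq // => p pS.
  by rewrite B0 // inj0 (lin0 (proj1 dpsi)).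
apply: eq_bigr => -[a b] _ /=; under eq_bigr => p _ do rewrite -tlift_sum.
rewrite -tlift_sum; apply: eq_tlift => u v /=.
rewrite (gdualE (f _) (proj1 dphi) uS S0) (gdualE (g _) (proj1 dpsi) uT T0).
by rewrite big_distrl; apply: eq_bigr => p _; rewrite big_distrr.
Qed.

Lemma continuous_id L : continuous (@idfun (dsum L)).
Proof.
by split=> // p; exists [:: p] => i; rewrite inE => ip v; apply: inj_out.
Qed.

Lemma pair_cmapl L1 L2 L1' (f : dsum L1 -> dsum L1') phi (psi : dsum L2 -> K^o) s :
  gdual phi -> gdual psi -> continuous f ->
  pair phi psi (cmap f idfun s) = pair (fun x => phi (f x)) psi s.
Proof. by move=> *; rewrite pair_cmap //; apply: continuous_id. Qed.

Lemma pair_cmapr L1 L2 L2' (g : dsum L2 -> dsum L2') (phi : dsum L1 -> K^o) psi s :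
  gdual phi -> gdual psi -> continuous g ->
  pair phi psi (cmap idfun g s) = pair phi (fun x => psi (g x)) s.
Proof. by move=> *; rewrite pair_cmap //; apply: continuous_id. Qed.

End GradedDual.

(** * Quasi-triangular structures on a graded pre-Lie algebra *)

Section Contraction.
Variables (K : fieldType) (L : int -> vectType K) (d : int).
Implicit Types (phi psi : dsum L -> K^o) (r : ctens L L).

(** This keeps contractions inside [dsum L]: a degree [q] in the support of the functional is
    matched only with the degree [d - q]. *)
Definition total_degree r : Prop := forall p q, p + q != d -> r (p, q) = 0.

Fact contract_key : unit. Proof. exact: tt. Qed.

(* The contraction [(id ⊗ psi) r] of a tensor of total degree [d]. Locked, since
   rewriting with [lin_sum] would otherwise see through it to the sum. *)
Definition contract r psi : dsum L := locked_with contract_key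
  (\sum_(q \in [set: int]) tlift (W := dsum L)
    (fun (u : L (d - q)) (v : L q) => (psi (inj v) : K) *: inj u) (r (d - q, q))).

Lemma contractE r phi psi : total_degree r -> gdual phi -> gdual psi ->
  pair phi psi r = phi (contract r psi).
Proof.
move=> rd dphi dpsi; have [S0 uS0 S00] := gdual_supp dphi.
have [T uT T0] := gdual_supp dpsi.
(* Besides the support of [phi], [S] has to contain every [d - q] with [q] in [T], since these are
   the only degrees that [r] pairs with [q]. *)
pose S := undup (S0 ++ [seq d - q | q <- T]).
have SP i : i \notin S -> forall v : L i, phi (inj v) = 0.
  by rewrite mem_undup mem_cat negb_or => /andP[/S00].
rewrite (pair_coverE _ (undup_uniq _) uT SP T0) exchange_big.
rewrite /contract locked_withE (fsbig_cover uT) => [|q /T0 q0]; last first.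
  by apply: tlift_eq0 => u v; rewrite q0 scale0r.
rewrite lin_sum ?(proj1 dphi) //; last by case: dphi.
apply: eq_big_seq => q qT /=.
rewrite (bigD1_seq (d - q)) ?undup_uniq //=; last first.
  by rewrite mem_undup mem_cat (map_f (fun q => d - q) qT) orbT.
rewrite big1 ?addr0 => [|p pq]; last first.
  rewrite rd ?(lin0 (test2_linear _ _)) //.
  by apply: contraNneq pq => <-; rewrite addrK.
rewrite linear_tlift; last by case: dphi.
by apply: eq_tlift => u v; rewrite linZ 1?mulrC //; case: dphi.
Qed.

Lemma total_degree_swap r : total_degree r -> total_degree (cswap r).
Proof.
by move=> rd p q pq; rewrite /cswap /= rd 1?addrC // /swap tlift0.
Qed.

Lemma contract_swapE r phi psi : total_degree r -> gdual phi -> gdual psi ->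
  pair phi psi r = psi (contract (cswap r) phi).
Proof.
move=> rd dphi dpsi; rewrite -pair_swap //.
by apply: contractE => //; apply: total_degree_swap.
Qed.

(** Tested against [phi], the contraction with [psi] is [psi] evaluated at the fixed element
    [contract d (cswap r) phi], which is additive in [psi]. *)
Lemma contract_sum r (J : Type) (s : seq J) (psi : J -> dsum L -> K^o) :
  total_degree r -> (forall j, gdual (psi j)) ->
  contract r (fun x => \sum_(j <- s) psi j x)
  = \sum_(j <- s) contract r (psi j).
Proof.
move=> rd dpsi; apply: gdual_eq => phi dphi; rewrite [in RHS](lin_sum (proj1 dphi)).
have dpsis := gdual_sum s dpsi.
rewrite -(contractE rd dphi dpsis) (contract_swapE rd dphi dpsis).
apply: eq_bigr => j _.
by rewrite -(contract_swapE rd dphi (dpsi j)) (contractE rd dphi (dpsi j)).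
Qed.

Lemma contract_homog r psi q :
  (forall i, i != q -> forall v : L i, psi (inj v) = 0) ->
  homog (d - q) (contract r psi).
Proof.
move=> psi0 k kq; rewrite /contract locked_withE (@fsbig_cover _ _ [:: q]) //; last first.
  move=> i; rewrite inE => iq; apply: tlift_eq0 => u v.
  by rewrite psi0 // scale0r.
rewrite big_seq1 /tlift component_sum big1 // => i _.
rewrite component_sum big1 // => j _.
by rewrite !componentZ inj_out 1?eq_sym // !scaler0.
Qed.

End Contraction.

(** * Continuity of multiplication operators in a graded algebra *)

Section Continuity.
Variables (K : fieldType) (L : int -> vectType K).

Lemma continuousB (f g : dsum L -> dsum L) :
  continuous f -> continuous g -> continuous (fun x => f x - g x).
Proof.
move=> [fl fc] [gl gc]; split=> [a x y|p].
  by rewrite fl gl scalerBr opprD addrACA.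
have [S S0] := fc p; have [T T0] := gc p; exists (S ++ T) => i.
rewrite mem_cat negb_or => /andP[iS iT] v.
have -> : f (inj v) - g (inj v) = f (inj v) + (-1) *: g (inj v).
  by rewrite scaleN1r.
by rewrite componentD componentZ S0 // T0 // scaler0 addr0.
Qed.

Variable mul : dsum L -> dsum L -> dsum L.
Hypotheses (mulb : is_bilinear mul) (mulg : graded_mul mul).

Lemma homog_inj i (v : L i) : homog i (inj v).
Proof. by move=> k ki; rewrite inj_out // eq_sym. Qed.

Lemma mul_injinj i j p (v : L i) (w : L j) :
  i + j != p -> mul (inj v) (inj w) p = 0.
Proof.
by move=> ijp; apply: (mulg (homog_inj v) (homog_inj w)); rewrite eq_sym.
Qed.

(** Only the degrees [p - i], with [i] in the finite support of [a], contribute to the component [p]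
    of the product. *)
Lemma continuous_mull a : continuous (mul a).
Proof.
split=> [|p]; first by case: mulb.
have [s us as0] := dsum_support a; exists [seq p - i | i <- s] => j js v.
rewrite (dsum_decomp us as0) (lin_sum (proj2 mulb (inj v))) component_sum.
rewrite big1_seq // => i /andP[_ si]; apply: mul_injinj.
by apply: contraNneq js => <-; apply/mapP; exists i => //; rewrite addrC addKr.
Qed.

Lemma continuous_mulr a : continuous (mul ^~ a).
Proof.
split=> [|p]; first by case: mulb.
have [s us as0] := dsum_support a; exists [seq p - i | i <- s] => j js v.
rewrite (dsum_decomp us as0) (lin_sum (proj1 mulb (inj v))) component_sum.
rewrite big1_seq // => i /andP[_ si]; apply: mul_injinj.
by apply: contraNneq js => <-; apply/mapP; exists i => //; rewrite addrK.
Qed.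

End Continuity.

(** Used as a certificate: [a = b] is a combination of known identities, and [x - y = a - b] is left
    to [ring]. *)
Lemma eq_by_difference (V : zmodType) (a b x y : V) :
  a = b -> x - y = a - b -> x = y.
Proof. by move=> -> /eqP; rewrite subrr subr_eq0 => /eqP. Qed.

(** * The dual product of the coboundary coproduct *)

Section QuasiTriangular.
Variables (K : fieldType) (L : int -> vectType K) (d : int).
Variables (mul : dsum L -> dsum L -> dsum L) (r : ctens L L).
Hypotheses (plm : pre_lie mul) (mulg : graded_mul mul) (rd : total_degree d r).
Implicit Types (phi psi chi : dsum L -> K^o) (x y z a b c : dsum L).

Local Notation rho := (contract d r).
Local Notation rho' := (contract d (cswap r)).

Let rhoE phi psi : gdual phi -> gdual psi -> pair phi psi r = phi (rho psi).
Proof. exact: contractE. Qed.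

Let rho'E phi psi : gdual phi -> gdual psi -> pair phi psi r = psi (rho' phi).
Proof. exact: contract_swapE. Qed.

Let mull a : linear (mul a). Proof. by case: plm => -[]. Qed.
Let mulr a : linear (mul ^~ a). Proof. by case: plm => -[]. Qed.
Let mulBl x y z : mul (x - y) z = mul x z - mul y z.
Proof. exact: (linB (mulr z)). Qed.
Let mulBr x y z : mul z (x - y) = mul z x - mul z y.
Proof. exact: (linB (mull z)). Qed.
Let mulNl x z : mul (- x) z = - mul x z. Proof. exact: (linN (mulr z)). Qed.
Let mulNr x z : mul z (- x) = - mul z x. Proof. exact: (linN (mull z)). Qed.
Let contl a : continuous (mul a).
Proof. by apply: continuous_mull => //; case: plm. Qed.
Let contr a : continuous (mul ^~ a).
Proof. by apply: continuous_mulr => //; case: plm. Qed.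
Let contlr a : continuous (fun y => mul a y - mul y a).
Proof. by apply: continuousB; [apply: contl|apply: contr]. Qed.
Let contrl a : continuous (fun y => mul y a - mul a y).
Proof. by apply: continuousB; [apply: contr|apply: contl]. Qed.
Let gl phi a : gdual phi -> gdual (fun x => phi (mul a x)).
Proof. by move=> dphi; apply: gdual_comp. Qed.
Let gr phi a : gdual phi -> gdual (fun x => phi (mul x a)).
Proof. by move=> dphi; apply: gdual_comp (contr a). Qed.
Let gB phi x y : gdual phi -> phi (x - y) = phi x - phi y.
Proof. by case=> lphi _; apply: linB. Qed.
Let gN phi x : gdual phi -> phi (- x) = - phi x.
Proof. by case=> lphi _; apply: linN. Qed.

(** The pre-Lie identity in scalar form, solved for one left-nested product, so that it can be used
    as a rewriting rule before [ring]. *)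
Let pl phi x y z : gdual phi -> phi (mul (mul x y) z)
  = phi (mul x (mul y z)) + phi (mul (mul y x) z) - phi (mul y (mul x z)).
Proof.
move=> dphi; have := congr1 phi (proj2 plm x y z); rewrite !gB // => E.
by rewrite -addrA -E; ring.
Qed.

Local Notation delta := (delta_r mul r).

(* The product on the graded dual of [L] dual to [delta]. *)
Definition conv phi psi : dsum L -> K^o :=
  fun x => - phi (mul x (rho psi)) - psi (mul x (rho' phi) - mul (rho' phi) x).

Lemma gdual_conv phi psi : gdual phi -> gdual psi -> gdual (conv phi psi).
Proof.
move=> dphi dpsi; apply: gdualB; first by apply: gdualN; apply: gr.
exact: gdual_comp (contrl _).
Qed.

Lemma pair_ad_op phi psi x s : gdual phi -> gdual psi ->
  pair phi psi (ad_op mul x s) = pair (fun y => phi (mul x y)) psi s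
    + pair phi (fun y => psi (mul x y - mul y x)) s.
Proof.
move=> dphi dpsi; rewrite /ad_op linD; last exact: pair_linear.
by rewrite (pair_cmapl _ dphi dpsi (contl x)) (pair_cmapr _ dphi dpsi (contlr x)).
Qed.

Lemma pair_delta phi psi x : gdual phi -> gdual psi ->
  pair phi psi (delta x) = conv phi psi x.
Proof.
move=> dphi dpsi; rewrite /delta_r linN; last exact: pair_linear.
rewrite pair_ad_op // rhoE ?rho'E //; [|exact: gdual_comp (contlr x)|exact: gl].
by rewrite /conv opprD.
Qed.

(** * Consequences of the contracted S-equation and of invariance *)

Local Notation dif phi := (rho phi - rho' phi).

Hypothesis S_dual : forall phi psi chi, gdual phi -> gdual psi -> gdual chi ->
  phi (mul (rho psi) (rho chi)) = psi (mul (rho' phi) (rho chi))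
    + chi (mul (rho' phi) (rho' psi) - mul (rho' psi) (rho' phi)).

Hypothesis inv_dual : forall a phi psi, gdual phi -> gdual psi ->
  phi (mul a (dif psi)) = psi (mul a (dif phi) - mul (dif phi) a).

Let dualE phi psi : gdual phi -> gdual psi -> phi (rho psi) = psi (rho' phi).
Proof. by move=> dphi dpsi; rewrite -rhoE // rho'E. Qed.

Let difE phi psi : gdual phi -> gdual psi -> phi (dif psi) = - psi (dif phi).
Proof.
by move=> dphi dpsi; rewrite !gB // dualE // (dualE dpsi dphi) opprB.
Qed.

(** Adding the instances of [inv_dual] for [phi, psi] and for [psi, phi] cancels all terms with [a]
    on the left. *)
Let inv_dualr a phi psi : gdual phi -> gdual psi ->
  phi (mul (dif psi) a) = - psi (mul (dif phi) a).
Proof.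
move=> dphi dpsi; have := inv_dual a dphi dpsi; have := inv_dual a dpsi dphi.
rewrite !gB // => E1 E2.
set t := phi (mul _ a) in E1 *.
have -> : t = phi (mul a (dif psi)) - (phi (mul a (dif psi)) - t) by ring.
by rewrite -E1 E2; ring.
Qed.

(** The skew-symmetry [difE] combined with [inv_dualr]: [dif] intertwines the transposed right
    multiplication with right multiplication. *)
Let difr phi a : gdual phi ->
  dif (fun y => phi (mul y a)) = mul (dif phi) a.
Proof.
move=> dphi; apply: gdual_eq => chi dchi.
rewrite difE //; last exact: gr.
by rewrite (inv_dualr a dphi dchi) opprK.
Qed.

(** Applying [chi] gives [conv phi psi] at [rho' chi], which is minus the right-hand side of
    [S_dual] for [chi, phi, psi]. *)
Let rho_conv phi psi : gdual phi -> gdual psi ->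
  rho (conv phi psi) = - mul (rho phi) (rho psi).
Proof.
move=> dphi dpsi; apply: gdual_eq => chi dchi.
rewrite dualE //; last exact: gdual_conv.
by rewrite gN // S_dual // /conv !gB //; ring.
Qed.

(** Applying [chi] gives [conv phi psi] at [rho chi]. Here [S_dual] for [phi, chi, psi] produces the
    factor [rho psi] where [rho' psi] is wanted, together with [psi] of the commutator of [rho' phi]
    and [dif chi]; invariance at [a = rho' phi] turns the latter into the missing correction. *)
Let rho'_conv phi psi : gdual phi -> gdual psi ->
  rho' (conv phi psi) = - mul (rho' phi) (rho' psi).
Proof.
move=> dphi dpsi; apply: gdual_eq => chi dchi.
rewrite -dualE //; last exact: gdual_conv.
rewrite gN // /conv S_dual // !gB //.
have := inv_dual (rho' phi) dchi dpsi; rewrite !mulBl !mulBr !gB // => E.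
have -> : chi (mul (rho' phi) (rho' psi)) = chi (mul (rho' phi) (rho psi))
    - (chi (mul (rho' phi) (rho psi)) - chi (mul (rho' phi) (rho' psi))).
  by ring.
by rewrite E; ring.
Qed.

Let convE phi psi x : gdual psi ->
  conv phi psi x
  = psi (mul (rho' phi) x) - psi (mul x (rho' phi)) - phi (mul x (rho psi)).
Proof. by move=> dpsi; rewrite /conv gB //; ring. Qed.

(** The instance of invariance behind [conv_pre_lie], where [c] is [rho chi]. With [D = dif psi],
    both sides are [phi] of [(x c) D - x (D c)]: the right one by [inv_dual] at [x c], and at [x]
    with the functional [psi (mul _ c)] and [difr]; the left one by the pre-Lie identity. *)
Let inv_dual_conv x c phi psi : gdual phi -> gdual psi ->
  phi (mul (mul x c) (dif psi) - mul (dif psi) (mul x c))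
    - phi (mul (mul x (dif psi) - mul (dif psi) x) c)
  = psi (mul (mul x c) (dif phi) - mul (dif phi) (mul x c))
    - psi (mul (mul x (dif phi) - mul (dif phi) x) c).
Proof.
move=> dphi dpsi; rewrite -[X in _ = X - _]inv_dual //.
rewrite -(inv_dual x dphi (gr c dpsi)) difr //.
by set D := rho psi - _; rewrite mulBl !gB // (pl x D c dphi); ring.
Qed.

Lemma conv_pre_lie phi psi chi x : gdual phi -> gdual psi -> gdual chi ->
  conv phi (conv psi chi) x - conv psi (conv phi chi) x
  = conv (conv phi psi) chi x - conv (conv psi phi) chi x.
Proof.
move=> dphi dpsi dchi; have dconv := gdual_conv.
have := inv_dual_conv x (rho chi) dphi dpsi.
rewrite !(convE _ _ (dconv _ _ _ _)) // !(convE _ _ dchi) // !rho_conv //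
  !rho'_conv // !convE //.
rewrite !mulNl !mulNr.
(* Once [rho] and [rho'] have been pushed through [conv], only these five contractions and [x] are
   left. The claim is then a sum of pre-Lie identities tested by [phi], [psi] and [chi], plus the
   single invariance relation [E]. *)
move: (rho phi) (rho' phi) (rho psi) (rho' psi) (rho chi) => q q' p p' c.
rewrite !mulBl !mulBr !mulBl !gB // !gN //.
rewrite (pl x p c dphi) (pl x q c dpsi).
rewrite (pl q' x p' dchi) (pl p' x q' dchi) (pl q' p' x dchi).
move=> E; apply: (eq_by_difference (esym E)); ring.
Qed.

(** In [conv phi psi - conv psi phi], invariance trades the products with [x] on the left for
    products with [x] on the right. *)
Let antisym_delta phi psi x : gdual phi -> gdual psi ->
  pair phi psi (delta x - cswap (delta x))
  = psi (mul (rho' phi) x) - phi (mul (rho psi) x).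
Proof.
move=> dphi dpsi; rewrite linB; last exact: pair_linear.
rewrite pair_swap // !pair_delta // !convE //.
have := inv_dual x dphi dpsi; have := inv_dualr x dphi dpsi.
rewrite !(mulBl, mulBr) !gB // => E1 E2.
by apply: (eq_by_difference (congr2 +%R (esym E2) E1)); ring.
Qed.

Lemma delta_linear : linear delta.
Proof.
move=> a x y; apply: pair_ext => phi psi dphi dpsi.
rewrite pair_linear // !pair_delta //.
exact: (proj1 (gdual_conv dphi dpsi)).
Qed.

Lemma bialgebra_compatibility1 a b :
  let antisym x : ctens L L := delta x - cswap (delta x) in
  antisym (mul a b) - cmap (mul a) idfun (antisym b)
  - cmap idfun (mul a) (antisym b) - cmap idfun (mul ^~ b) (delta a)
  + cmap (mul ^~ b) idfun (cswap (delta a)) = 0.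
Proof.
move=> antisym; apply: pair_ext => phi psi dphi dpsi.
have antiE f g x : gdual f -> gdual g -> pair f g (antisym x)
    = g (mul (rho' f) x) - f (mul (rho g) x) by exact: antisym_delta.
clearbody antisym; have lp := pair_linear dphi dpsi.
have [la ra] := (fun f => @gl f a, fun f => @gr f b).
rewrite (lin0 lp) (linD lp) !(linB lp).
rewrite (pair_cmapl _ dphi dpsi (contl a)).
rewrite (pair_cmapl _ dphi dpsi (contr b)).
rewrite (pair_cmapr _ dphi dpsi (contl a)).
rewrite (pair_cmapr _ dphi dpsi (contr b)).
rewrite (pair_swap _ dpsi (ra _ dphi)) !antiE ?pair_delta ?convE //;
  try by [apply: la|apply: ra].
(* [E1], [E2] and [E3] eliminate the contractions of the composite functionals such as
   [phi (mul a _)] and [psi (mul _ b)]. What is left is the pre-Lie identity tested by [phi] and by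
   [psi]. *)
have E1 := dualE (gl a dphi) (gr b dpsi).
have E2 := dualE (gr b dphi) (gl a dpsi).
have := inv_dual a dpsi (gr b dphi).
rewrite !(mulBl, mulBr) !gB // => E3.
rewrite (pl a (rho' phi) b dpsi).
apply: (eq_by_difference (congr2 +%R (congr2 +%R E1 E2) (esym E3))).
by rewrite (pl a (rho psi) b dphi); ring.
Qed.

Lemma bialgebra_compatibility2 a b :
  delta (mul a b - mul b a)
  - cmap idfun (fun y => mul y b - mul b y) (delta a)
  - cmap idfun (fun y => mul a y - mul y a) (delta b)
  - cmap (mul a) idfun (delta b) + cmap (mul b) idfun (delta a) = 0.
Proof.
apply: pair_ext => phi psi dphi dpsi.
have lp := pair_linear dphi dpsi.
have dpsia := gdual_comp dpsi (contlr a); have dpsib := gdual_comp dpsi (contrl b).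
rewrite (lin0 lp) (linD lp) !(linB lp).
rewrite (pair_cmapl _ dphi dpsi (contl a)) (pair_cmapl _ dphi dpsi (contl b)).
rewrite (pair_cmapr _ dphi dpsi (contrl b)) (pair_cmapr _ dphi dpsi (contlr a)).
rewrite !pair_delta //; try exact: gl.
(* Duality of [rho] and [rho'] accounts for the contractions of composite functionals; the remaining
   terms cancel by the pre-Lie identity. *)
have E1 := dualE (gl b dphi) dpsia; have E2 := dualE (gl a dphi) dpsib.
apply: (eq_by_difference (congr2 +%R E1 E2)); rewrite /conv.
rewrite !(mulBl, mulBr) !gB // (pl a b _ dpsi) (pl a _ b dpsi) (pl b _ a dpsi).
by rewrite (pl a b _ dphi); ring.
Qed.

(** * Finiteness and the coalgebra identity, component by component *)

Let linear_conc p (lam : L p -> K^o) : linear lam ->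
  forall i, i != p -> forall v : L i, lam (inj v p) = 0.
Proof. by move=> ll i ip v; rewrite inj_out // lin0. Qed.

(** [delta] is homogeneous of degree [d], because [rho] and [rho'] turn a functional of degree [q]
    into an element of degree [d - q]. Hence a single bidegree contributes to each component of the
    iterated coproducts. *)
Lemma delta_degree i (v : L i) p q : p + q != i + d -> delta (inj v) (p, q) = 0.
Proof.
move=> pq; apply: tens_ext => lam mu ll lm; rewrite (lin0 (test2_linear _ _)).
have dphi := gdual_conc ll; have dpsi := gdual_conc lm.
rewrite -pair_conc // pair_delta // convE //.
have hl : homog (d - p) (rho' (fun x => lam (x p))).
  by apply: contract_homog => j jp w; rewrite inj_out // lin0.
have hr : homog (d - q) (rho (fun x => mu (x q))).
  by apply: contract_homog => j jp w; rewrite inj_out // lin0.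
rewrite (mulg hl (homog_inj v)) ?(mulg (homog_inj v) hl) ?(mulg (homog_inj v) hr).
- by rewrite (lin0 ll) (lin0 lm) !subr0.
- by apply: contraNneq pq => ->; apply/eqP; ring.
- by apply: contraNneq pq => ->; apply/eqP; ring.
- by apply: contraNneq pq => ->; apply/eqP; ring.
Qed.

Let id_delta0 t1 t2 t3 p q : (p, q) \notin [:: (t1, t2 + t3 - d)] ->
  forall (u : L p) (v : L q), id_delta delta (inj u) (inj v) (t1, t2, t3) = 0.
Proof.
rewrite inE xpair_eqE negb_and => /orP[pt|qt] u v; rewrite /id_delta.
  by apply: tlift_eq0 => v' w; rewrite (inj_out u pt) !tens0l.
by rewrite delta_degree ?tlift0 //; apply: contraNneq qt => ->; rewrite addrK.
Qed.

Let delta_id0 t1 t2 t3 p q : (p, q) \notin [:: (t1 + t2 - d, t3)] ->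
  forall (u : L p) (v : L q), delta_id delta (inj u) (inj v) (t1, t2, t3) = 0.
Proof.
rewrite inE xpair_eqE negb_and => /orP[pt|qt] u v; rewrite /delta_id.
  rewrite delta_degree ?tens0l //; apply: contraNneq pt => ->.
  by rewrite addrK.
by rewrite (inj_out v qt) tens0r.
Qed.

Section Components.
Variables (t1 t2 t3 : int).
Variables (lam : L t1 -> K^o) (mu : L t2 -> K^o) (nu : L t3 -> K^o).
Hypotheses (ll : linear lam) (lm : linear mu) (ln : linear nu).
Let phi : dsum L -> K^o := fun x => lam (x t1).
Let psi : dsum L -> K^o := fun x => mu (x t2).
Let chi : dsum L -> K^o := fun x => nu (x t3).
Let dphi : gdual phi. Proof. exact: gdual_conc. Qed.
Let dpsi : gdual psi. Proof. exact: gdual_conc. Qed.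
Let dchi : gdual chi. Proof. exact: gdual_conc. Qed.

(** Iterating [delta] is dual to iterating [conv]; this and [test3_delta_id] turn the coalgebra
    identity into [conv_pre_lie]. *)
Lemma test3_id_delta x :
  test3 lam mu nu (ext (id_delta delta) (delta x) (t1, t2, t3)
    : tens (tens (L t1) (L t2)) (L t3))
  = conv phi (conv psi chi) x.
Proof.
rewrite -pair_delta //; last exact: gdual_conv.
rewrite (linear_ext (@id_delta0 t1 t2 t3) _ (test3_linear _ _ _)).
apply: eq_fsbigr => -[p q] _; apply: eq_tlift => u v /=.
rewrite /id_delta /= (linear_tlift _ _ (test3_linear _ _ _)).
rewrite -pair_delta // pair_conc // /test2.
rewrite (linear_tlift _ _ (h := fun y : K^o => phi (inj u) * y : K^o)).
  by apply: eq_tlift => v' w; rewrite test3_tens // mulrA.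
by move=> a y z; rewrite mulrDr; congr (_ + _); apply: mulrCA.
Qed.

Lemma test3_delta_id x :
  test3 lam mu nu (ext (delta_id delta) (delta x) (t1, t2, t3)
    : tens (tens (L t1) (L t2)) (L t3))
  = conv (conv phi psi) chi x.
Proof.
rewrite -pair_delta //; last exact: gdual_conv.
rewrite (linear_ext (@delta_id0 t1 t2 t3) _ (test3_linear _ _ _)).
apply: eq_fsbigr => -[p q] _; apply: eq_tlift => u v /=.
rewrite /delta_id /= /test3 tlift_tensv; last first.
  by apply: is_bilinearM => //; apply: test2_linear.
by rewrite -pair_conc // pair_delta.
Qed.

End Components.

Lemma delta_coalgebra : completed_pre_lie_coalgebra delta.
Proof.
split=> [|x|x I_delta delta_I]; first exact: delta_linear.
  split=> -[[t1 t2] t3].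
    exact: (extendable_cover (@id_delta0 t1 t2 t3)).
  exact: (extendable_cover (@delta_id0 t1 t2 t3)).
apply: cprodP => -[[t1 t2] t3]; apply: test3_ext => lam mu nu ll lm ln.
rewrite -[(I_delta - _) _]/(I_delta (t1, t2, t3) - cswap12 I_delta (t1, t2, t3)).
rewrite -[(delta_I - _) _]/(delta_I (t1, t2, t3) - cswap12 delta_I (t1, t2, t3)).
rewrite !(linB (test3_linear _ _ _)) /cswap12 /= !test3_swap //.
rewrite !test3_id_delta // !test3_delta_id //.
by apply: conv_pre_lie; apply: gdual_conc.
Qed.

(** * The S-equation and the invariance of the difference *)

Let pair_cover phi psi N : uniq N ->
  (forall p q, (p, q) \notin N -> r (p, q) <> 0 ->
     (forall u : L p, phi (inj u) = 0) \/ (forall v : L q, psi (inj v) = 0)) ->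
  \sum_(pq <- N) test2 (fun u : L pq.1 => phi (inj u))
    (fun v : L pq.2 => psi (inj v)) (r pq) = pair phi psi r.
Proof.
move=> uN N0; rewrite /pair (fsbig_cover uN) // => -[p q] pqN.
have [->|/eqP r0] := eqVneq (r (p, q)) 0; first exact: (lin0 (test2_linear _ _)).
by have [u0|v0] := N0 _ _ pqN r0; [apply: test2_eq0l|apply: test2_eq0r].
Qed.

Section SComponent.
Variables (t1 t2 t3 : int).

(* Only bidegrees of total degree [d] with one degree among the [t_i] can
   contribute to the component [(t1, t2, t3)]. *)
Definition S_bidegrees : seq (int * int) :=
  undup (flatten [seq [:: (t, d - t); (d - t, t)] | t <- [:: t1; t2; t3]]).

Lemma S_bidegreesN p q : (p, q) \notin S_bidegrees -> r (p, q) <> 0 ->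
  [/\ [/\ p != t1, p != t2 & p != t3] & [/\ q != t1, q != t2 & q != t3]].
Proof.
move=> pqN r0; have pq : p + q = d by apply/eqP; apply: contra_notT r0 => /rd.
have -> : p = d - q by rewrite -pq addrK.
have {}pqN t : t \in [:: t1; t2; t3] -> p != t /\ q != t.
  move=> tt; split; apply: contraNneq pqN => E; rewrite mem_undup;
    apply/flatten_mapP; exists t => //.
    by rewrite inE -E -pq addrC addKr eqxx.
  by rewrite !inE -E -pq addrK eqxx orbT.
have E t : (d - q != t) = (p != t) by rewrite -pq addrK.
rewrite !E; have [? ?] := pqN t1 (mem_head _ _).
have [|? ?] := pqN t2; first by rewrite !inE eqxx orbT.
have [|? ?] := pqN t3; first by rewrite !inE eqxx !orbT.
by split; split.
Qed.

(** In every summand of [S_elem], each of the two terms of [r] leaves one factor outside the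
    product, alone in one of the three slots. A bidegree off the list makes that factor vanish
    there. *)
Lemma S_term_eq0 i j :
  (i, j) \notin [seq (k, l) | k <- S_bidegrees, l <- S_bidegrees] ->
  S_term mul r (t1, t2, t3) (i, j) = 0.
Proof.
move=> ij; rewrite /S_term /=.
have [->|/eqP ri] := eqVneq (r i) 0; first exact: tlift0.
have [->|/eqP rj] := eqVneq (r j) 0.
  by apply: tlift_eq0 => u v; apply: tlift0.
apply: tlift_eq0 => u v; apply: tlift_eq0 => u' v'.
rewrite -[LHS]/(mul (inj u) (inj u') t1 ⊗ inj v t2 ⊗ inj v' t3
  - inj u t1 ⊗ mul (inj v) (inj u') t2 ⊗ inj v' t3
  - inj u t1 ⊗ inj u' t2 ⊗ lie mul (inj v) (inj v') t3).
have [iN|iN] := boolP (i \in S_bidegrees); last first.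
  case: i iN u v {ij} ri => p q iN u v ri.
  have [[p1 _ _] [_ q2 _]] := S_bidegreesN iN ri.
  by rewrite (inj_out u p1) (inj_out v q2) !(tens0l, tens0r) !subr0.
have [jN|jN] := boolP (j \in S_bidegrees); last first.
  case: j jN u' v' {ij} rj => p q jN u' v' rj.
  have [[_ p2 _] [_ _ q3]] := S_bidegreesN jN rj.
  by rewrite (inj_out u' p2) (inj_out v' q3) !(tens0l, tens0r) !subr0.
by case/negP: ij; apply: allpairs_f.
Qed.

End SComponent.

Lemma S_solution : completed_S_solution mul r.
Proof.
move=> [[t1 t2] t3]; pose N := S_bidegrees t1 t2 t3.
have uN : uniq N by apply: undup_uniq.
have S0 := @S_term_eq0 t1 t2 t3.
have uNN : uniq [seq (k, l) | k <- N, l <- N].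
  by apply: allpairs_uniq => // -[? ?] [? ?] /=.
split.
  apply: (sub_finite_set (B := [set` [seq (k, l) | k <- N, l <- N]])).
    move=> [i j] /= ij0; apply: contraT => /S0 E; by rewrite E eqxx in ij0.
  exact: finite_seq.
rewrite (fsbig_cover uNN) => [|[i j] /S0 //].
rewrite big_allpairs; apply: test3_ext => lam mu nu ll lm ln.
rewrite (lin0 (test3_linear _ _ _)) lin_sum; last exact: test3_linear.
pose phi : dsum L -> K^o := fun x => lam (x t1).
pose psi : dsum L -> K^o := fun x => mu (x t2).
pose chi : dsum L -> K^o := fun x => nu (x t3).
have dphi : gdual phi by apply: gdual_conc.
have dpsi : gdual psi by apply: gdual_conc.
have dchi : gdual chi by apply: gdual_conc.
(* If one of the two functionals is concentrated in a degree among the [t_i], the list [N] suffices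
   for the pairing, whatever the other functional is; in use, that one may be composed with a
   product. *)
have coverl f g p : p \in [:: t1; t2; t3] ->
    (forall i, i != p -> forall u : L i, f (inj u) = 0) ->
    \sum_(pq <- N) test2 (fun u : L pq.1 => f (inj u))
      (fun v : L pq.2 => g (inj v)) (r pq) = pair f g r.
  move=> tp f0; apply: pair_cover => // p' q' /S_bidegreesN H /H[[p1 p2 p3] _].
  left; apply: f0; move: tp; rewrite !inE.
  by case/or3P => /eqP ->.
have coverr f g q : q \in [:: t1; t2; t3] ->
    (forall i, i != q -> forall u : L i, g (inj u) = 0) ->
    \sum_(pq <- N) test2 (fun u : L pq.1 => f (inj u))
      (fun v : L pq.2 => g (inj v)) (r pq) = pair f g r.
  move=> tp f0; apply: pair_cover => // p' q' /S_bidegreesN H /H[_ [p1 p2 p3]].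
  right; apply: f0; move: tp; rewrite !inE.
  by case/or3P => /eqP ->.
have phi0 := linear_conc ll; have psi0 := linear_conc lm.
have chi0 := linear_conc ln.
have [i1 i2 i3] : [/\ t1 \in [:: t1; t2; t3], t2 \in [:: t1; t2; t3]
    & t3 \in [:: t1; t2; t3]].
  by rewrite !inE !eqxx !orbT.
(* The sum over [j] is carried out first: testing the second copy of [r] by [chi] on the right gives
   [rho chi], and testing it by [psi] on the left gives [rho' psi]. The sum over [i] is then another
   pairing with [r]. *)
transitivity (\sum_(i <- N) tlift (fun (u : L i.1) (v : L i.2) =>
    psi (inj v) * phi (mul (inj u) (rho chi))
    - phi (inj u) * psi (mul (inj v) (rho chi))
    - phi (inj u) * chi (mul (inj v) (rho' psi) - mul (rho' psi) (inj v))
    : K^o) (r i)).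
  apply: eq_bigr => i _; rewrite lin_sum; last exact: test3_linear.
  transitivity (\sum_(j <- N) tlift (fun (u : L i.1) (v : L i.2) =>
      tlift (fun (u' : L j.1) (v' : L j.2) => test3 lam mu nu
        (S_elem mul (inj u) (inj v) (inj u') (inj v') (t1, t2, t3))) (r j)) (r i)).
    apply: eq_bigr => j _; rewrite /S_term (linear_tlift _ _ (test3_linear _ _ _)).
    by apply: eq_tlift => u v; rewrite (linear_tlift _ _ (test3_linear _ _ _)).
  rewrite -tlift_sum; apply: eq_tlift => u v.
  transitivity (\sum_(j <- N) tlift (fun (u' : L j.1) (v' : L j.2) =>
      psi (inj v) *: (phi (mul (inj u) (inj u')) * chi (inj v') : K^o)
      - phi (inj u) *: (psi (mul (inj v) (inj u')) * chi (inj v') : K^o)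
      - phi (inj u) *: (psi (inj u')
          * chi (mul (inj v) (inj v') - mul (inj v') (inj v)) : K^o)
      : K^o) (r j)).
    apply: eq_bigr => j _; apply: eq_tlift => u' v'.
    rewrite -[S_elem _ _ _ _ _ _]/(mul (inj u) (inj u') t1 ⊗ inj v t2 ⊗ inj v' t3
      - inj u t1 ⊗ mul (inj v) (inj u') t2 ⊗ inj v' t3
      - inj u t1 ⊗ inj u' t2 ⊗ lie mul (inj v) (inj v') t3).
    rewrite !(linB (test3_linear _ _ _)) !test3_tens //.
    rewrite -![_ *: _]/(_ * _).
    by rewrite /phi /psi /chi /lie; ring.
  under eq_bigr => j _ do rewrite !tliftB !tliftZ.
  rewrite !sumrB -!scaler_sumr.
  rewrite (coverr (fun x => phi (mul (inj u) x)) chi _ i3 chi0).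
  rewrite (coverr (fun x => psi (mul (inj v) x)) chi _ i3 chi0).
  rewrite (coverl psi (fun x => chi (mul (inj v) x - mul x (inj v))) _ i2 psi0).
  rewrite [pair psi _ r]rho'E //; last exact: gdual_comp (contlr _).
  by rewrite !rhoE //; apply: gl.
under eq_bigr => i _ do rewrite !tliftB.
rewrite !sumrB.
rewrite (coverl phi (fun y => psi (mul y (rho chi))) _ i1 phi0).
rewrite (coverl phi (fun y => chi (mul y (rho' psi) - mul (rho' psi) y)) _ i1 phi0).
have -> : \sum_(i <- N) tlift (fun (u : L i.1) (v : L i.2) =>
    psi (inj v) * phi (mul (inj u) (rho chi)) : K^o) (r i)
    = pair (fun x => phi (mul x (rho chi))) psi r.
  rewrite -(coverr (fun x => phi (mul x (rho chi))) psi _ i2 psi0).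
  by apply: eq_bigr => i _; apply: eq_tlift => u v; apply: mulrC.
rewrite [pair _ psi r]rhoE //; last exact: gr.
rewrite !rho'E //; [|exact: gdual_comp (contrl _)|exact: gr].
by rewrite S_dual //; ring.
Qed.

Lemma difference_invariant : completed_invariant mul (r - cswap r).
Proof.
move=> x; apply: pair_ext => phi psi dphi dpsi.
have lp := pair_linear dphi dpsi.
rewrite pair_ad_op // (lin0 lp).
have dlphi := gl x dphi; have dcpsi := gdual_comp dpsi (contlr x).
rewrite (linB (pair_linear dlphi dpsi)) (linB (pair_linear dphi dcpsi)).
rewrite (pair_swap _ dpsi dlphi) (pair_swap _ dcpsi dphi).
rewrite (rhoE dlphi dpsi) (rho'E dpsi dlphi) (rho'E dphi dcpsi) (rhoE dcpsi dphi).
have := inv_dual x dphi dpsi; rewrite !(mulBr, mulBl) !gB // => E.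
by apply: (eq_by_difference E); ring.
Qed.

Lemma quasi_triangular_of_dual : completed_quasi_triangular mul r.
Proof.
split; [|exact: S_solution|exact: difference_invariant].
split=> //; first exact: delta_coalgebra.
  exact: bialgebra_compatibility1.
exact: bialgebra_compatibility2.
Qed.

End QuasiTriangular.

(** * The pre-Lie algebra A ⊗ B *)

Section AffinizedProduct.
Variables (K : fieldType) (A : vectType K) (B : int -> vectType K).
Variables (succ prec : A -> A -> A) (dia : dsum B -> dsum B -> dsum B).
Hypotheses (ldA : leibniz_dendriform succ prec) (zinB : zinbiel dia).
Hypothesis diag : graded_mul dia.

Local Notation L := (AB A B).
Local Notation mul := (AB_mul succ prec dia).
Local Notation tensA := (@tensA K A B).

Lemma inj_tens i (a : A) (x : B i) : inj (a ⊗ x : L i) = tensA a (inj x).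
Proof.
apply: dsumP => j; rewrite -[RHS]/(a ⊗ inj x j).
have [ij|ij] := eqVneq i j; last by rewrite !inj_out // tens0r.
by subst j; rewrite !inj_in.
Qed.

Lemma tensA_ext (W : lmodType K) (f g : dsum L -> W) :
  linear f -> linear g -> (forall a x, f (tensA a x) = g (tensA a x)) ->
  f =1 g.
Proof.
move=> fl gl fg X; have [s us Xs] := dsum_support X.
rewrite (dsum_decomp us Xs) !lin_sum //; apply: eq_bigr => i _.
apply: (@tlift_uniq K A (B i) W (fun v => f (inj v)) (fun v => g (inj v))).
- by move=> c v w; rewrite inj_linear fl.
- by move=> c v w; rewrite inj_linear gl.
- by move=> a x; rewrite inj_tens.
Qed.

Lemma AB_mul_bilinear : is_bilinear mul.
Proof.
split=> [X c Y Y'|Y c X X']; last exact: liftA_linear.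
by apply: liftA_linear_fun => a x; apply: liftA_linear.
Qed.

Let mull X : linear (mul X). Proof. exact: (proj1 AB_mul_bilinear X). Qed.
Let mulr X : linear (mul ^~ X). Proof. exact: (proj2 AB_mul_bilinear X). Qed.

Let succb : is_bilinear succ. Proof. by case: ldA. Qed.
Let precb : is_bilinear prec. Proof. by case: ldA. Qed.

Let mulE a b x y : mul (tensA a x) (tensA b y)
  = tensA (succ a b) (dia x y) - tensA (prec b a) (dia y x).
Proof. by apply: AB_mul_tensA => //; case: zinB. Qed.

Lemma componentB (X Y : dsum L) i : (X - Y) i = X i - Y i.
Proof. by rewrite -scaleN1r componentD componentZ scaleN1r. Qed.

Lemma AB_mul_graded : graded_mul mul.
Proof.
have dec i (X : dsum L) : homog i X -> X = inj (X i).
  move=> hX; rewrite [LHS](@dsum_decomp _ _ _ [:: i]) ?big_seq1 // => j.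
  by rewrite inE => /hX.
move=> i j X Y /dec -> /dec -> k kij.
have inj_dia p q (x : B p) (y : B q) : p + q != k -> dia (inj x) (inj y) k = 0.
  by move=> pq; apply: (diag (homog_inj x) (homog_inj y)); rewrite eq_sym.
apply: (@tlift_uniq K A (B i) (L k) (fun v => mul (inj v) (inj (Y j)) k)
   (fun _ => 0)) => [c v w|c v w|a x].
- by rewrite inj_linear mulr.
- by rewrite scaler0 addr0.
apply: (@tlift_uniq K A (B j) (L k) (fun v => mul (inj (a ⊗ x : L i)) (inj v) k)
   (fun _ => 0)) => [c v w|c v w|b y].
- by rewrite inj_linear mull.
- by rewrite scaler0 addr0.
rewrite !inj_tens mulE componentB.
rewrite -[X in X - _]/(_ ⊗ dia (inj x) (inj y) k).
rewrite -[X in _ - X]/(_ ⊗ dia (inj y) (inj x) k).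
have ijk : i + j != k by rewrite eq_sym.
by rewrite !inj_dia ?tens0r ?subr0 // addrC.
Qed.

Lemma AB_mul_pre_lie : pre_lie mul.
Proof.
split; first exact: AB_mul_bilinear.
move=> X Y Z.
have [ml mr] := (mull, mulr).
pose f X Y Z := mul (mul X Y) Z - mul X (mul Y Z).
pose g X Y Z := mul (mul Y X) Z - mul Y (mul X Z).
suff fg a x b y c z : f (tensA a x) (tensA b y) (tensA c z)
                    = g (tensA a x) (tensA b y) (tensA c z).
  apply: (tensA_ext (f := fun X => f X Y Z) (g := fun X => g X Y Z)) X
    => [c X X'|c X X'|a x].
  - by rewrite /f !(mr, ml) scalerBr opprD addrACA.
  - by rewrite /g !(mr, ml) scalerBr opprD addrACA.
  apply: (tensA_ext (f := fun Y => f (tensA a x) Y Z)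
    (g := fun Y => g (tensA a x) Y Z)) Y => [c Y Y'|c Y Y'|b y].
  - by rewrite /f !(mr, ml) scalerBr opprD addrACA.
  - by rewrite /g !(mr, ml) scalerBr opprD addrACA.
  apply: (tensA_ext (f := f (tensA a x) (tensA b y))
    (g := g (tensA a x) (tensA b y))) Z => [c Z Z'|c Z Z'|c z].
  - by rewrite /f !(mr, ml) scalerBr opprD addrACA.
  - by rewrite /g !(mr, ml) scalerBr opprD addrACA.
  exact: fg.
rewrite {}/f {}/g.
(* Testing by a functional makes the identity one between scalars, within reach of [ring]. *)
apply: gdual_eq => phi [lphi _].
rewrite !mulE !(linB (mr _)) !(linB (ml _)) !mulE !(linB lphi).
have [tl tr] := @tensA_bilinear K A B.
have Zin := proj2 zinB.
have [_ _ ax1 ax2 ax3] := ldA.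
(* The Zinbiel identity makes all products in [B] left-nested. The axioms of [A] are then solved for
   [(p ≻ q) ≻ s], [(p ≻ q) ≺ s] and [(p ≺ q) ≺ s], so that [(p ≺ q) ≻ s] is the only left-nested
   form remaining in [A]. *)
rewrite !Zin !(linD (tl _)) !(linD lphi).
have ax1' p q s w : phi (tensA (succ (succ p q) s) w)
   = phi (tensA (succ p (succ q s)) w) - phi (tensA (succ q (succ p s)) w)
     - phi (tensA (succ (prec p q) s) w).
  have := ax1 p q s; rewrite /circ (linD (proj2 succb s)).
  move=> /(congr1 (fun a => phi (tensA a w))).
  by rewrite (linD (tr _)) (linB (tr _)) (linD lphi) (linB lphi) => <-; ring.
have ax2' p q s w : phi (tensA (prec (succ p q) s) w)
   = phi (tensA (succ p (prec q s)) w) - phi (tensA (prec q (succ p s)) w)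
     - phi (tensA (prec q (prec p s)) w).
  have := ax2 p q s; rewrite /circ (linD (proj1 precb q)).
  move=> /(congr1 (fun a => phi (tensA a w))).
  by rewrite !(linD (tr _)) !(linD lphi) => <-; ring.
have ax3' p q s w : phi (tensA (prec (prec p q) s) w)
   = phi (tensA (prec p (succ q s)) w) + phi (tensA (prec p (prec q s)) w)
     - phi (tensA (succ q (prec p s)) w).
  have := ax3 p q s; rewrite /circ (linD (proj1 precb p)).
  move=> /(congr1 (fun a => phi (tensA a w))).
  by rewrite !(linD (tr _)) !(linD lphi) => ->; ring.
by rewrite !(ax1', ax2', ax3'); ring.
Qed.

End AffinizedProduct.

(** * Dual bases *)

Section DualBases.
Variables (K : fieldType) (B : int -> vectType K).
Variables (omega : dsum B -> dsum B -> K).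
Variables (Omega : choiceType) (e f : Omega -> dsum B).
Hypotheses (omegab : is_bilinear_form omega) (dual_ef : dual_bases omega e f).
Hypothesis omega_nondeg : forall x, (forall y, omega x y = 0) -> x = 0.
Hypothesis e_homog : forall j, homogeneous (e j).

Lemma omega_linearr x : linear (omega x : dsum B -> K^o).
Proof. exact: (proj1 omegab x). Qed.

Lemma omega_linearl y : linear (omega ^~ y : dsum B -> K^o).
Proof. exact: (proj2 omegab y). Qed.

Let omega_ef i j : omega (e i) (f j) = (i == j)%:R.
Proof. by case: dual_ef. Qed.

Lemma omega_f_finite x : exists2 F : seq Omega, uniq F &
  forall j, j \notin F -> omega x (f j) = 0.
Proof.
have [[_ /(_ x) [s [c ->]]] _ _] := dual_ef.
exists (undup s) => [|j]; first exact: undup_uniq.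
rewrite mem_undup => js; rewrite (lin_sum (omega_linearl (f j))) big1_seq //.
move=> k /andP[_ sk]; rewrite (linZ (omega_linearl (f j))) omega_ef.
by rewrite (_ : (k == j) = false) ?scaler0 //; apply: contraNF js => /eqP <-.
Qed.

Lemma omega_f_eq x y : (forall j, omega x (f j) = omega y (f j)) -> x = y.
Proof.
move=> xy; apply/eqP; rewrite -subr_eq0; apply/eqP/omega_nondeg => z.
have [_ [_ /(_ z) [s [c ->]]] _] := dual_ef.
rewrite (lin_sum (omega_linearr _)) big1 // => j _.
rewrite (linZ (omega_linearr _)) (linB (omega_linearl _)) xy subrr.
exact: scaler0.
Qed.

Lemma omega_f_expand x F : uniq F ->
  (forall j, j \notin F -> omega x (f j) = 0) ->
  x = \sum_(j <- F) omega x (f j) *: e j.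
Proof.
move=> uF F0; apply: omega_f_eq => l.
rewrite (lin_sum (omega_linearl _)).
under eq_bigr => j _ do rewrite (linZ (omega_linearl _)) omega_ef.
have [lF|lF] := boolP (l \in F).
  rewrite (bigD1_seq l) //= eqxx big1 => [|j /negPf ->]; last exact: mulr0.
  by rewrite -[_ *: _]/(_ * _) mulr1 addr0.
rewrite F0 // big1_seq // => j /andP[_ jF].
by rewrite (_ : (j == l) = false) ?scaler0 //; apply: contraNF lF => /eqP <-.
Qed.

(** An [e j] with a nonzero component in degree [i] lies in the finite-dimensional [B i]. Each
    vector of a basis of [B i] is orthogonal to almost all [f j], whereas
    [omega (e j) (f j) = 1]. *)
Lemma e_locally_finite i : exists2 F : seq Omega, uniq F &
  forall j, j \notin F -> e j i = 0.
Proof.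
pose b k := inj (vbasis {:B i})`_k : dsum B.
have /choice[F F0] k : exists F : seq Omega,
    forall j, j \notin F -> omega (b k) (f j) = 0.
  by have [F _ F0] := omega_f_finite (b k); exists F.
exists (undup (flatten [seq F k | k <- iota 0 (\dim {:B i})])).
  exact: undup_uniq.
move=> j; rewrite mem_undup => /flatten_mapP jF.
apply/eqP; apply: contraT => eji.
have [a ha] := e_homog j.
have ia : i = a by apply/eqP; apply: contraT => /ha E; rewrite E eqxx in eji.
subst a; have : omega (e j) (f j) = 0.
  have -> : e j = inj (e j i).
    by rewrite [LHS](@dsum_decomp _ _ _ [:: i]) ?big_seq1 // => k; rewrite inE => /ha.
  rewrite (coord_vbasis (memvf (e j i))) (lin_sum (@inj_linear _ _ _)).
  rewrite (lin_sum (omega_linearl _)) big1 // => k _.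
  rewrite (linZ (@inj_linear _ _ _)) (linZ (omega_linearl _)).
  have -> : omega (inj (vbasis {:B i})`_k) (f j) = 0.
    apply: F0; apply/negP => jk; case: jF; exists (val k) => //.
    by rewrite mem_iota /= add0n ltn_ord.
  exact: scaler0.
by rewrite omega_ef eqxx => /eqP; rewrite oner_eq0.
Qed.

Lemma gdual_e_finite (g : dsum B -> K^o) : gdual g ->
  exists2 F : seq Omega, uniq F & forall j, j \notin F -> g (e j) = 0.
Proof.
move=> dg; have [S uS S0] := gdual_supp dg.
have /choice[F F0] i : exists F : seq Omega, forall j, j \notin F -> e j i = 0.
  by have [F _ F0] := e_locally_finite i; exists F.
exists (undup (flatten [seq F i | i <- S])); first exact: undup_uniq.
move=> j; rewrite mem_undup => /flatten_mapP jF.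
rewrite (gdualE _ (proj1 dg) uS S0) big1_seq // => i /andP[_ iS].
rewrite F0 ?inj0 ?(lin0 (proj1 dg)) //; apply/negP => ji.
by case: jF; exists i.
Qed.

Hypothesis omegaC : forall x y, omega x y = - omega y x.

(** [omega] identifies [B] with its graded dual. The sum over the dual basis is finite because [g]
    kills almost all [e j]; its sign compensates [omega (f j) (e j) = -1]. *)
Lemma gdual_omega_repr (g : dsum B -> K^o) : gdual g ->
  exists y, forall x, g x = omega y x.
Proof.
move=> dg; have [F uF F0] := gdual_e_finite dg.
exists (- \sum_(j <- F) (g (e j) : K) *: f j) => x.
have [[_ /(_ x) [s [c ->]]] _ _] := dual_ef.
rewrite (lin_sum (proj1 dg)) (lin_sum (omega_linearr _)).
apply: eq_bigr => l _; rewrite (linZ (proj1 dg)) (linZ (omega_linearr _)).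
congr (_ *: _); rewrite omegaC (linN (omega_linearr _)) opprK.
rewrite (lin_sum (omega_linearr _)).
under eq_bigr => j _ do rewrite (linZ (omega_linearr _)) omega_ef.
have [lF|lF] := boolP (l \in F).
  rewrite (bigD1_seq l) //= eqxx big1 => [|j jl]; last first.
    by rewrite eq_sym (negPf jl) scaler0.
  by rewrite -[_ *: _]/(_ * _) mulr1 addr0.
rewrite F0 // big1_seq // => j /andP[_ jF].
by rewrite (_ : (l == j) = false) ?scaler0 //; apply: contraNF lF => /eqP ->.
Qed.

End DualBases.

(** * The affinization of r *)

Section AffinizedTensor.
Variables (K : fieldType) (A : vectType K) (succ prec : A -> A -> A).
Variables (n : nat) (u v : 'I_n -> A).
Variables (B : int -> vectType K).
Variables (dia : dsum B -> dsum B -> dsum B) (omega : dsum B -> dsum B -> K).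
Variables (Omega : choiceType) (e f : Omega -> dsum B) (m : int).
Hypothesis ldA : leibniz_dendriform succ prec.
Hypotheses (zinB : zinbiel dia) (diag : graded_mul dia).
Hypothesis omegab : is_bilinear_form omega.
Hypothesis omegag : forall i j x y,
  homog i x -> homog j y -> i + j + m != 0 -> omega x y = 0.
Hypothesis omegaC : forall x y, omega x y = - omega y x.
Hypothesis omega_nondeg : forall x, (forall y, omega x y = 0) -> x = 0.
Hypothesis omega_inv :
  forall x y z, omega (dia x y) z = omega y (dia x z + dia z x).
Hypothesis dual_ef : dual_bases omega e f.
Hypotheses (e_homog : forall j, homogeneous (e j))
  (f_homog : forall j, homogeneous (f j)).

Local Notation L := (AB A B).
Local Notation mul := (AB_mul succ prec dia).
Local Notation tensA := (@tensA K A B).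
Local Notation rh := (rhat u v e f).
Local Notation rho := (contract (- m) rh).
Local Notation rho' := (contract (- m) (cswap rh)).
Implicit Types (x y z w : dsum B) (a b c : A) (alpha beta gamma : A -> K^o).
Implicit Types (phi psi chi : dsum L -> K^o).

Let omr := omega_linearr omegab.
Let oml := omega_linearl omegab.
Let tensl x : linear (tensA ^~ x). Proof. exact: (proj2 (@tensA_bilinear K A B)). Qed.
Let tensr a : linear (tensA a). Proof. exact: (proj1 (@tensA_bilinear K A B)). Qed.

Let omega_ef i j : omega (e i) (f j) = (i == j)%:R.
Proof. by case: dual_ef. Qed.

Lemma cprod_sumE (T : Type) (W : T -> vectType K) (J : Type) (s : seq J)
    (g : J -> cprod W) t :
  (\sum_(j <- s) g j) t = \sum_(j <- s) g j t.
Proof. by elim/big_rec2: _ => // j y z _ <-. Qed.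

(** The degrees of [e j] and [f j] add up to [- m], since otherwise [omega (e j) (f j)] would be 0
    and not 1. *)
Lemma rhat_total_degree : total_degree (- m) rh.
Proof.
move=> p q pq; rewrite /rhat cprod_sumE big1 // => i _; apply: fsbig1 => j _.
have [k hk] := e_homog j; have [l hl] := f_homog j.
have kl : k + l + m = 0.
  apply/eqP; apply: contraT => /(omegag hk hl) /eqP.
  by rewrite omega_ef eqxx oner_eq0.
rewrite -[LHS]/((u i ⊗ e j p) ⊗ (v i ⊗ f j q)).
have [pk|/hk ->] := eqVneq p k; last by rewrite tens0r tens0l.
have [ql|/hl ->] := eqVneq q l; last by rewrite !tens0r.
by case/eqP: pq; rewrite pk ql; apply/eqP; rewrite -addr_eq0 kl.
Qed.

Lemma pair_rhat phi psi : gdual phi -> gdual psi ->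
  pair phi psi rh = \sum_(j \in [set: Omega])
    \sum_(i < n) phi (tensA (u i) (e j)) * psi (tensA (v i) (f j)).
Proof.
move=> dphi dpsi; have [S uS S0] := gdual_supp dphi.
have [T uT T0] := gdual_supp dpsi.
(* Only finitely many [e j] have components in the degrees seen by [phi], so the sum over [Omega]
   reduces to [F] and can be exchanged with the sums over bidegrees. *)
have [F uF F0] : exists2 F : seq Omega, uniq F &
    forall j, j \notin F -> forall p, p \in S -> e j p = 0.
  have /choice[G G0] i : exists F : seq Omega, forall j, j \notin F -> e j i = 0.
    by have [F _ F0] := e_locally_finite omegab dual_ef e_homog i; exists F.
  exists (undup (flatten [seq G i | i <- S])); first exact: undup_uniq.
  move=> j; rewrite mem_undup => /flatten_mapP jF p pS.
  by rewrite G0 //; apply/negP => ji; case: jF; exists p.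
have tensAE a x S' (g : dsum L -> K^o) : gdual g -> uniq S' ->
    (forall i, i \notin S' -> forall w : L i, g (inj w) = 0) ->
    g (tensA a x) = \sum_(p <- S') g (inj (a ⊗ x p : L p)).
  by move=> dg uS' S'0; rewrite (gdualE _ (proj1 dg) uS' S'0).
rewrite (fsbig_cover uF) => [|j /F0 ej]; last first.
  rewrite big1 // => i _; rewrite (tensAE _ _ S) // big1_seq ?mul0r // => p /andP[_ pS].
  by rewrite ej // tens0r inj0 (lin0 (proj1 dphi)).
rewrite (pair_coverE _ uS uT S0 T0).
transitivity (\sum_(p <- S) \sum_(q <- T) \sum_(i < n) \sum_(j <- F)
    phi (inj (u i ⊗ e j p : L p)) * psi (inj (v i ⊗ f j q : L q))).
  apply: eq_big_seq => p pS; apply: eq_bigr => q _.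
  rewrite /rhat cprod_sumE (lin_sum (test2_linear _ _)); apply: eq_bigr => i _.
  rewrite /csum (fsbig_cover uF) => [|j /F0 ej]; last first.
    rewrite -[LHS]/((u i ⊗ e j p) ⊗ (v i ⊗ f j q)).
    by rewrite ej // tens0r tens0l.
  rewrite (lin_sum (test2_linear _ _)); apply: eq_bigr => j _.
  rewrite -[X in test2 _ _ X]/((u i ⊗ e j p) ⊗ (v i ⊗ f j q)).
  by rewrite test2_tens //; apply: gdual_inj.
under eq_bigr => p _ do rewrite exchange_big.
rewrite exchange_big /= [RHS]exchange_big /=; apply: eq_bigr => i _.
under eq_bigr => p _ do rewrite exchange_big.
rewrite exchange_big /=; apply: eq_bigr => j _.
rewrite (tensAE _ _ S) // (tensAE _ _ T) // big_distrl; apply: eq_bigr => p _.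
by rewrite big_distrr.
Qed.

(* The functional [alpha ⊗ omega(y, -)] on [A ⊗ B]. *)
Definition ten alpha y : dsum L -> K^o :=
  liftA (W := K^o) (fun a x => alpha a * omega y x : K^o).

Lemma tenE alpha y a x : linear alpha ->
  ten alpha y (tensA a x) = alpha a * omega y x.
Proof.
by move=> la; rewrite /ten liftA_tensA //; apply: (@is_bilinearM K A (dsum B)).
Qed.

Lemma gdual_omega y : gdual (omega y : dsum B -> K^o).
Proof.
split; first exact: omr.
have [s us ys] := dsum_support y; exists [seq - m - i | i <- s] => j js w.
rewrite (dsum_decomp us ys) (lin_sum (oml _)) big1_seq // => i /andP[_ si].
apply: (omegag (homog_inj _) (homog_inj _)).
apply: contraNneq js => E; apply/mapP; exists i => //.
by rewrite -[RHS]addr0 -E; ring.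
Qed.

Lemma gdual_ten alpha y : linear alpha -> gdual (ten alpha y).
Proof.
move=> la; have lt : linear (ten alpha y) by apply: liftA_linear.
split=> //; have [S uS S0] := gdual_supp (gdual_omega y); exists S => i iS w.
apply: (@tlift_uniq K A (B i) K^o (fun t => ten alpha y (inj t)) (fun _ => 0))
  => [c w1 w2|c w1 w2|a x].
- by rewrite inj_linear lt.
- by rewrite scaler0 addr0.
- by rewrite inj_tens tenE // S0 // mulr0.
Qed.

(** A basis of [A] splits [phi] into functionals on [B], and each of these is represented through
    [omega]. *)
Lemma gdual_ten_expand phi : gdual phi ->
  exists y : 'I_(\dim {:A}) -> dsum B,
    phi = fun X => \sum_k ten (coord (vbasis {:A}) k) (y k) X.
Proof.
move=> dphi; have [S uS S0] := gdual_supp dphi.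
have /choice[y yE] (k : 'I_(\dim {:A})) :
    exists y, forall x, phi (tensA (vbasis {:A})`_k x) = omega y x.
  apply: (gdual_omega_repr omegab dual_ef e_homog omegaC
           (g := fun x => phi (tensA (vbasis {:A})`_k x))); split.
    by move=> c x x'; rewrite tensr (proj1 dphi).
  by exists S => i iS w; rewrite -inj_tens S0.
exists y; apply/funext; apply: tensA_ext => [|c X Y|a x].
- by case: dphi.
- rewrite scaler_sumr -big_split; apply: eq_bigr => k _ /=.
  by rewrite (proj1 (gdual_ten _ _)) // => c' b b'; rewrite linearP.
rewrite {1}(coord_vbasis (memvf a)) (lin_sum (tensl x)) (lin_sum (proj1 dphi)).
apply: eq_bigr => k _; rewrite (linZ (tensl x)) (linZ (proj1 dphi)) yE.
by rewrite tenE // => c b b'; rewrite linearP.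
Qed.

(** [rl beta] and [rr alpha] are the contractions [(id ⊗ beta) r] and [(alpha ⊗ id) r] of the finite
    tensor. *)
Definition rl beta : A := \sum_(i < n) (beta (v i) : K) *: u i.
Definition rr alpha : A := \sum_(i < n) (alpha (u i) : K) *: v i.

(** The sum over [Omega] collapses through the expansion of [y] with coefficients [omega y (f j)] on
    the [e j]. *)
Lemma contract_ten beta y : linear beta ->
  rho (ten beta y) = tensA (rl beta) y.
Proof.
move=> lb; apply: gdual_eq => phi dphi.
rewrite -contractE //; try exact: gdual_ten; try exact: rhat_total_degree.
rewrite pair_rhat //; last exact: gdual_ten.
have [F uF F0] := omega_f_finite omegab dual_ef y.
rewrite (fsbig_cover uF) => [|j /F0 yj]; last first.
  by rewrite big1 // => i _; rewrite tenE // yj !mulr0.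
rewrite [y in RHS](omega_f_expand omegab dual_ef omega_nondeg uF F0).
rewrite (lin_sum (tensr _)) (lin_sum (proj1 dphi)); apply: eq_bigr => j _.
rewrite (linZ (tensr _)) (linZ (proj1 dphi)) (lin_sum (tensl _)).
rewrite (lin_sum (proj1 dphi)) scaler_sumr; apply: eq_bigr => i _.
rewrite (linZ (tensl _)) (linZ (proj1 dphi)) tenE //.
by rewrite -![_ *: _]/(_ * _); ring.
Qed.

(** Here [e] and [f] exchange roles with respect to the opposite form; the sign is the skew-symmetry
    of [omega]. *)
Lemma contract_swap_ten alpha y : linear alpha ->
  rho' (ten alpha y) = - tensA (rr alpha) y.
Proof.
move=> la; apply: gdual_eq => psi dpsi.
rewrite -contract_swapE //; try exact: gdual_ten; try exact: rhat_total_degree.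
rewrite pair_rhat //; last exact: gdual_ten.
have omegab' : is_bilinear_form (fun x y => omega y x).
  by split=> x; [apply: oml|apply: omr].
have dual_fe : dual_bases (fun x y => omega y x) f e.
  by case: dual_ef => ? ? _; split=> // i j; rewrite omega_ef eq_sym.
have nondeg' x : (forall y, omega y x = 0) -> x = 0.
  by move=> x0; apply: omega_nondeg => z; rewrite omegaC x0 oppr0.
have [F uF F0] := omega_f_finite omegab' dual_fe y.
rewrite (fsbig_cover uF) => [|j /F0 yj]; last first.
  by rewrite big1 // => i _; rewrite tenE // omegaC yj oppr0 mulr0 mul0r.
rewrite [y in RHS](omega_f_expand omegab' dual_fe nondeg' uF F0).
rewrite (lin_sum (tensr _)) -sumrN (lin_sum (proj1 dpsi)); apply: eq_bigr => j _.
rewrite (linZ (tensr _)) (linN (proj1 dpsi)) (linZ (proj1 dpsi)) (lin_sum (tensl _)).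
rewrite (lin_sum (proj1 dpsi)) scaler_sumr -sumrN; apply: eq_bigr => i _.
rewrite (linZ (tensl _)) (linZ (proj1 dpsi)) tenE // omegaC.
by rewrite -![_ *: _]/(_ * _); ring.
Qed.

(** * The LD-YBE and invariance in contracted form, and their transfer to the affinization *)

Section Conditions.
Variable r : tens A A.
Hypothesis rE : r = \sum_(i < n) u i ⊗ v i.

Lemma test2_rl alpha beta : linear alpha -> linear beta ->
  test2 alpha beta r = alpha (rl beta).
Proof.
move=> la lb; rewrite rE (lin_sum (test2_linear _ _)) (lin_sum la).
by apply: eq_bigr => i _; rewrite test2_tens // (linZ la) mulrC.
Qed.

Lemma test2_rr alpha beta : linear alpha -> linear beta ->
  test2 alpha beta r = beta (rr alpha).
Proof.
move=> la lb; rewrite rE (lin_sum (test2_linear _ _)) (lin_sum lb).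
by apply: eq_bigr => i _; rewrite test2_tens // (linZ lb).
Qed.

Lemma test2_tmap (g h : A -> A) alpha beta s :
  linear alpha -> linear beta -> test2 alpha beta (tmap g h s)
  = test2 (fun a => alpha (g a)) (fun a => beta (h a)) s.
Proof.
move=> la lb; rewrite /tmap (linear_tlift _ _ (test2_linear _ _)).
by apply: eq_tlift => a b; rewrite test2_tens.
Qed.

Let sl a : linear (succ a). Proof. by case: ldA => -[]. Qed.
Let sr a : linear (succ ^~ a). Proof. by case: ldA => -[]. Qed.
Let pl a : linear (prec a). Proof. by case: ldA => _ []. Qed.
Let pr a : linear (prec ^~ a). Proof. by case: ldA => _ []. Qed.

Let linear_comp alpha (g : A -> A) :
  linear alpha -> linear g -> linear (fun a => alpha (g a)).
Proof. by move=> la lg c a b; rewrite lg la. Qed.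

Let circl a : linear (circ succ prec a).
Proof. by move=> c x y; rewrite /circ sl pl scalerDr addrACA. Qed.
Let circr a : linear (fun b => circ succ prec b a).
Proof. by move=> c x y; rewrite /circ sr pr scalerDr addrACA. Qed.
Let odotl a : linear (odot succ prec a).
Proof. by move=> c x y; rewrite /odot sl pr scalerDr addrACA. Qed.
Let odotr a : linear (fun b => odot succ prec b a).
Proof. by move=> c x y; rewrite /odot sr pl scalerDr addrACA. Qed.
Let starl a : linear (star succ prec a).
Proof. by move=> c x y; rewrite /star circl circr [in RHS]scalerDr addrACA. Qed.

Lemma LD_YBE_dual alpha beta gamma : LD_YBE succ prec r ->
  linear alpha -> linear beta -> linear gamma ->
  gamma (circ succ prec (rr beta) (rr alpha))
  = beta (odot succ prec (rr alpha) (rl gamma))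
    + alpha (succ (rl beta) (rl gamma)).
Proof.
move=> /(congr1 (test3 alpha beta gamma)) ybe la lb lg.
move: ybe; rewrite (lin0 (test3_linear _ _ _)).
rewrite (linear_tlift _ _ (test3_linear _ _ _)).
(* [F] is the tested equation as a function of the outer pair [u_i, v_i], with the inner copy of [r]
   already contracted. *)
pose F (a b : A) : K^o := beta a * gamma (circ succ prec b (rr alpha))
  - alpha a * beta (odot succ prec b (rl gamma))
  - alpha (succ a (rl gamma)) * beta b.
have -> : tlift (fun ui vi => test3 alpha beta gamma (tlift (fun uj vj =>
    uj ⊗ ui ⊗ circ succ prec vi vj - ui ⊗ odot succ prec vi uj ⊗ vj
    - succ ui uj ⊗ vi ⊗ vj) r)) r = tlift F r.
  apply: eq_tlift => a b; rewrite (linear_tlift _ _ (test3_linear _ _ _)).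
  transitivity (tlift (fun a' b' =>
      beta a *: (alpha a' * gamma (circ succ prec b b') : K^o)
      - alpha a *: (beta (odot succ prec b a') * gamma b' : K^o)
      - beta b *: (alpha (succ a a') * gamma b' : K^o) : K^o) r).
    apply: eq_tlift => a' b'; rewrite !(linB (test3_linear _ _ _)) !test3_tens //.
    by rewrite -![_ *: _]/(_ * _); ring.
  rewrite !tliftB !tliftZ.
  rewrite -[LHS]/(beta a * test2 alpha (fun t => gamma (circ succ prec b t)) r
    - alpha a * test2 (fun t => beta (odot succ prec b t)) gamma r
    - beta b * test2 (fun t => alpha (succ a t)) gamma r).
  rewrite test2_rr //; last exact: linear_comp.
  rewrite !test2_rl //; try exact: linear_comp.
  by rewrite /F; ring.
rewrite !tliftB.
rewrite -[X in X = _ -> _]/(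
    test2 beta (fun t => gamma (circ succ prec t (rr alpha))) r
  - test2 alpha (fun t => beta (odot succ prec t (rl gamma))) r
  - test2 (fun t => alpha (succ t (rl gamma))) beta r).
have lc := linear_comp lg (circr (rr alpha)).
have lo := linear_comp lb (odotr (rl gamma)).
have ls := linear_comp la (sr (rl gamma)).
rewrite (test2_rr lb lc) (test2_rr la lo) (test2_rl ls lb) => E.
by apply: (eq_by_difference E); ring.
Qed.

(** [rl + rr] is the contraction of [r + swap r], on either side because this tensor is
    symmetric. *)
Lemma LD_invariant_dual alpha beta a : LD_invariant succ prec (r + swap r) ->
  linear alpha -> linear beta ->
  alpha (odot succ prec a (rl beta + rr beta))
    = beta (circ succ prec (rl alpha + rr alpha) a) /\
  alpha (star succ prec a (rl beta + rr beta))
    = beta (prec (rl alpha + rr alpha) a).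
Proof.
move=> /(_ a)[d1 d2] la lb.
have t2 (al be : A -> K^o) : linear al -> linear be ->
    test2 al be (r + swap r) = al (rl be + rr be).
  move=> lal lbe; rewrite (linD (test2_linear _ _)) test2_swap //.
  by rewrite (linD lal) test2_rl // test2_rr.
have t2' (al be : A -> K^o) : linear al -> linear be ->
    test2 al be (r + swap r) = be (rl al + rr al).
  move=> lal lbe; rewrite (linD (test2_linear _ _)) test2_swap //.
  by rewrite (linD lbe) test2_rr // test2_rl // addrC.
have lo := linear_comp la (odotl a); have lc := linear_comp lb (circr a).
have ls := linear_comp la (starl a); have lp := linear_comp lb (pr a).
split.
  have := congr1 (test2 alpha beta) d1; rewrite /Delta_succ.
  rewrite (linB (test2_linear _ _)) (lin0 (test2_linear _ _)) !test2_tmap //.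
  by rewrite (t2 _ _ lo lb) (t2' _ _ la lc) => /eqP; rewrite subr_eq0 => /eqP.
have := congr1 (test2 alpha beta) d2; rewrite /Delta_prec.
rewrite (linB (test2_linear _ _)) (lin0 (test2_linear _ _)) !test2_tmap //.
rewrite (test2_swap _ lb ls) (test2_swap _ lp la).
by rewrite (t2' _ _ lb ls) (t2 _ _ lp la) => /eqP; rewrite subr_eq0 => /eqP.
Qed.

Let ml X : linear (mul X). Proof. exact: (proj1 (AB_mul_bilinear succ prec dia) X). Qed.
Let mr X : linear (mul ^~ X). Proof. exact: (proj2 (AB_mul_bilinear succ prec dia) X). Qed.
Let mulE a b x y : mul (tensA a x) (tensA b y)
  = tensA (succ a b) (dia x y) - tensA (prec b a) (dia y x).
Proof. by apply: AB_mul_tensA; case: ldA zinB => ? ? _ _ _ []. Qed.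

(** With [omega_diar], this reduces every value of [omega] on a product of [x], [y], [z] to the
    scalars [P] and [Q] of the computations below. *)
Let omega_dial x y z :
  omega y (dia z x) = - (omega x (dia y z) + omega x (dia z y)).
Proof. by rewrite omegaC omega_inv (linD (omr _)) addrC. Qed.

Let omega_diar x y z : omega y (dia x z) = omega x (dia y z).
Proof.
have := omega_inv z y x; rewrite omegaC (linD (omr _)) (omega_dial x y z) => E.
by apply: (eq_by_difference (esym E)); ring.
Qed.

Lemma S_dual_rhat_ten alpha beta gamma x y z :
  LD_YBE succ prec r -> LD_invariant succ prec (r + swap r) ->
  linear alpha -> linear beta -> linear gamma ->
  let phi := ten alpha x in let psi := ten beta y in let chi := ten gamma z in
  phi (mul (rho psi) (rho chi)) = psi (mul (rho' phi) (rho chi))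
    + chi (mul (rho' phi) (rho' psi) - mul (rho' psi) (rho' phi)).
Proof.
move=> ybe inv la lb lg phi psi chi.
rewrite {}/phi {}/psi {}/chi !contract_ten // !contract_swap_ten //.
rewrite !(linN (mr _)) !(linN (ml _)) !opprK !mulE.
rewrite !(linB (proj1 (gdual_ten _ _))) // !(linN (proj1 (gdual_ten _ _))) //.
rewrite !(linB (proj1 (gdual_ten _ _))) // !tenE //.
set P := omega x (dia y z); set Q := omega x (dia z y).
have -> : omega y (dia x z) = P by apply: omega_diar.
have -> : omega y (dia z x) = - (P + Q) by apply: omega_dial.
have -> : omega z (dia x y) = Q by apply: omega_diar.
have -> : omega z (dia y x) = - (P + Q) by rewrite (omega_dial x z y) addrC.
have E1 := LD_YBE_dual ybe la lb lg.
have E2 := LD_YBE_dual ybe lb la lg.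
have [I1 I2] := LD_invariant_dual (rl gamma) inv la lb.
(* The coefficient of [P] is [E1]. That of [Q] is [E1] corrected by [E2], which has [alpha] and
   [beta] exchanged, and by the two invariance relations at [rl gamma]. *)
have /eq_by_difference := congr2 +%R
  (congr1 ( *%R (P + Q)) (esym E1)) (congr1 ( *%R Q)
    (congr2 +%R (esym E2) (congr2 +%R I1 (esym I2)))).
apply; move: E1 E2 I1 I2 => _ _ _ _.
rewrite /circ /odot /star /circ.
rewrite !((linD (sl _)), (linD (pl _)), (linD (sr _)), (linD (pr _))).
rewrite !((linD la), (linD lb), (linD lg)).
by ring.
Qed.

Lemma inv_dual_rhat_ten alpha beta a x y z :
  LD_invariant succ prec (r + swap r) -> linear alpha -> linear beta ->
  let phi := ten alpha y in let psi := ten beta z in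
  let dif phi := rho phi - rho' phi in
  phi (mul (tensA a x) (dif psi))
  = psi (mul (tensA a x) (dif phi) - mul (dif phi) (tensA a x)).
Proof.
move=> inv la lb phi psi dif.
have difE (al : A -> K^o) t : linear al -> dif (ten al t) = tensA (rl al + rr al) t.
  move=> lal; rewrite /dif contract_ten // contract_swap_ten // opprK.
  by rewrite (linD (tensl t)).
rewrite {}/phi {}/psi !difE // !mulE !(linB (proj1 (gdual_ten _ _))) // !tenE //.
set P := omega x (dia y z); set Q := omega x (dia z y).
have -> : omega y (dia x z) = P by apply: omega_diar.
have -> : omega y (dia z x) = - (P + Q) by apply: omega_dial.
have -> : omega z (dia x y) = Q by apply: omega_diar.
have -> : omega z (dia y x) = - (P + Q) by rewrite (omega_dial x z y) addrC.
have [I1 _] := LD_invariant_dual a inv la lb.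
have [_ I2] := LD_invariant_dual a inv lb la.
(* The first invariance condition is the coefficient of [P]; the second, with [alpha] and [beta]
   exchanged, is that of [Q]. *)
have /eq_by_difference := congr2 +%R
  (congr1 ( *%R P) I1) (congr1 ( *%R Q) (esym I2)).
apply; move: I1 I2 => _ _.
move: (rl _ + _) (rl _ + _) => db da.
rewrite /circ /odot /star /circ !((linD la), (linD lb)).
ring.
Qed.

Let gd_sum (y : 'I_(\dim {:A}) -> dsum B) k :
  gdual (ten (coord (vbasis {:A}) k) (y k)).
Proof. by apply: gdual_ten => c a b; rewrite linearP. Qed.

Let rho_sum (y : 'I_(\dim {:A}) -> dsum B) :
  rho (fun X => \sum_k ten (coord (vbasis {:A}) k) (y k) X)
  = \sum_k rho (ten (coord (vbasis {:A}) k) (y k)).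
Proof. by apply: contract_sum; [apply: rhat_total_degree|apply: gd_sum]. Qed.

Let rho'_sum (y : 'I_(\dim {:A}) -> dsum B) :
  rho' (fun X => \sum_k ten (coord (vbasis {:A}) k) (y k) X)
  = \sum_k rho' (ten (coord (vbasis {:A}) k) (y k)).
Proof.
apply: contract_sum; last exact: gd_sum.
exact/total_degree_swap/rhat_total_degree.
Qed.

Lemma S_dual_rhat phi psi chi :
  LD_YBE succ prec r -> LD_invariant succ prec (r + swap r) ->
  gdual phi -> gdual psi -> gdual chi ->
  phi (mul (rho psi) (rho chi)) = psi (mul (rho' phi) (rho chi))
    + chi (mul (rho' phi) (rho' psi) - mul (rho' psi) (rho' phi)).
Proof.
move=> ybe inv dphi dpsi dchi.
have lc k : linear (coord (vbasis {:A}) k : A -> K^o).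
  by move=> c a b; rewrite linearP.
have [x phiE] := gdual_ten_expand dphi.
have [y psiE] := gdual_ten_expand dpsi.
have [z chiE] := gdual_ten_expand dchi.
rewrite phiE rho'_sum !(lin_sum (mr _)) !(lin_sum (ml _)) -sumrB.
rewrite (lin_sum (proj1 dpsi)) (lin_sum (proj1 dchi)) -big_split.
apply: eq_bigr => k _ /=; rewrite psiE rho_sum rho'_sum.
rewrite !(lin_sum (mr _)) !(lin_sum (ml _)) -sumrB.
rewrite (lin_sum (proj1 (gd_sum x k))) (lin_sum (proj1 dchi)) -big_split.
apply: eq_bigr => l _ /=; rewrite chiE rho_sum !(lin_sum (ml _)).
rewrite (lin_sum (proj1 (gd_sum x k))) (lin_sum (proj1 (gd_sum y l))) -big_split.
by apply: eq_bigr => h _ /=; apply: S_dual_rhat_ten.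
Qed.

Lemma inv_dual_rhat X phi psi : LD_invariant succ prec (r + swap r) ->
  gdual phi -> gdual psi ->
  phi (mul X (rho psi - rho' psi))
  = psi (mul X (rho phi - rho' phi) - mul (rho phi - rho' phi) X).
Proof.
move=> inv dphi dpsi.
have lc k : linear (coord (vbasis {:A}) k : A -> K^o).
  by move=> c a b; rewrite linearP.
have [y phiE] := gdual_ten_expand dphi.
have [z psiE] := gdual_ten_expand dpsi.
rewrite phiE rho_sum rho'_sum -sumrB !(lin_sum (mr _)) !(lin_sum (ml _)) -sumrB.
rewrite (lin_sum (proj1 dpsi)).
apply: eq_bigr => k _ /=; rewrite psiE rho_sum rho'_sum -sumrB.
rewrite (lin_sum (ml _)) (lin_sum (proj1 (gd_sum y k))).
apply: eq_bigr => l _ /=.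
set D1 := _ - _; set D2 := _ - rho' _.
apply: (tensA_ext (f := fun X => ten _ _ (mul X D1))
  (g := fun X => ten _ _ (mul X D2 - mul D2 X))) X => [c X Y|c X Y|a x].
- by rewrite mr (proj1 (gd_sum y k)).
- by rewrite mr ml -(proj1 (gd_sum z l)) scalerBr opprD addrACA.
exact: inv_dual_rhat_ten.
Qed.

(** Skew-symmetry of [r] gives [rl + rr = 0], and this sign cancels the one coming from [omega], so
    [rho] and [rho'] agree on all functionals [ten alpha y]. *)
Lemma rhat_symmetric : swap r = - r -> cswap rh = rh.
Proof.
move=> rskew; have dl0 (al : A -> K^o) : linear al -> rl al + rr al = 0.
  move=> lal; rewrite (coord_vbasis (memvf (_ + _))) big1 // => k _.
  have lc : linear (coord (vbasis {:A}) k : A -> K^o).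
    by move=> c a b; rewrite linearP.
  have := linD (test2_linear (coord (vbasis {:A}) k : A -> K^o) al) r (swap r).
  rewrite rskew subrr (lin0 (test2_linear _ _)) -rskew test2_swap //.
  by rewrite test2_rl // test2_rr // -(linD lc) => <-; rewrite scale0r.
apply: pair_ext => phi psi dphi dpsi; rewrite (pair_swap _ dpsi dphi).
rewrite (contract_swapE rhat_total_degree dpsi dphi).
rewrite (contractE rhat_total_degree dphi dpsi).
congr (phi _); have [y ->] := gdual_ten_expand dpsi.
rewrite rho_sum rho'_sum; apply: eq_bigr => k _.
have lc : linear (coord (vbasis {:A}) k : A -> K^o).
  by move=> c a b; rewrite linearP.
rewrite contract_ten // contract_swap_ten //.
by rewrite -(addr0_eq (dl0 _ lc)) (linN (tensl _)) opprK.
Qed.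

Lemma rhat_quasi_triangular :
  LD_YBE succ prec r -> LD_invariant succ prec (r + swap r) ->
  completed_quasi_triangular mul rh.
Proof.
move=> ybe inv; apply: (quasi_triangular_of_dual (d := - m)).
- exact: AB_mul_pre_lie.
- exact: AB_mul_graded.
- exact: rhat_total_degree.
- by move=> phi psi chi; apply: S_dual_rhat.
- by move=> X phi psi; apply: inv_dual_rhat.
Qed.

End Conditions.

End AffinizedTensor.

Theorem theorem2p32 (K : fieldType)
    (A : vectType K) (succ prec : A -> A -> A)
    (n : nat) (u v : 'I_n -> A) (r : tens A A)
    (B : int -> vectType K)
    (dia : dsum B -> dsum B -> dsum B) (omega : dsum B -> dsum B -> K)
    (Omega : choiceType) (e f : Omega -> dsum B) :
  leibniz_dendriform succ prec ->
  r = \sum_(i < n) u i ⊗ v i ->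
  quadratic_graded_zinbiel dia omega ->
  dual_bases omega e f ->
  (forall j, homogeneous (e j)) ->
  (forall j, homogeneous (f j)) ->
  (quasi_triangular_LD_bialgebra succ prec r ->
     completed_quasi_triangular (AB_mul succ prec dia) (rhat u v e f)) /\
  (triangular_LD_bialgebra succ prec r ->
     completed_triangular (AB_mul succ prec dia) (rhat u v e f)).
Proof.
move=> ldA rE [[zinB diag] [omegab [m omegag]] omegaC nondeg inv] dual he hf.
have qt : quasi_triangular_LD_bialgebra succ prec r ->
    completed_quasi_triangular (AB_mul succ prec dia) (rhat u v e f).
  by case=> _ ybe invr; exact: (rhat_quasi_triangular ldA zinB diag omegab
    omegag omegaC nondeg inv dual he hf rE).
split=> // -[/qt ? rskew]; split=> //.
exact: (rhat_symmetric omegab omegag omegaC nondeg dual he hf rE).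
Qed.
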